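(* Let $K$ be a field, let $m\ge1$ be an integer, let $S=K[x_1,x_2,x_3,x_4]$, and let $L(m)\subseteq\mathbb Z^4$ be the lattice generated by $(m+4,-(m+1),-1,-1)$, $(-(m+1),-3,-1,m+4)$ and $(-1,m+3,-(m+1),-1)$. Then the ring $S/I_{L(m)}$ has Betti numbers $$\beta_0(S/I_{L(m)})=1,\quad \beta_1(S/I_{L(m)})=7,\quad \beta_2(S/I_{L(m)})=12,\quad \beta_3(S/I_{L(m)})=6,$$ and $\beta_i(S/I_{L(m)})=0$ for every $i\ge4$. Consequently, the algebraic Scarf complex of $I_{L(m)}$ has $f$-vector $(f_0,f_1,f_2)=(7,12,6)$.
   Context: For a lattice (subgroup) $L\subseteq\mathbb Z^4$, the lattice ideal is $I_L=\langle \mathbf x^{\mathbf u^+}-\mathbf x^{\mathbf u^-}\mid\mathbf u\in L\rangle\subseteq S$, where $(\mathbf u^+)_i=\max\{u_i,0\}$ and $(\mathbf u^-)_i=\max\{-u_i,0\}$. The ideal $I_{L(m)}$ is homogeneous for the positive grading $\deg x_i=n_i$ with $n_1=m^3+7m^2+21m+20$, $n_2=m^3+8m^2+25m+25$, $n_3=m^3+8m^2+26m+25$, $n_4=m^3+8m^2+28m+30$. The Betti number $\beta_i(S/I_{L(m)})$ is the rank of the $i$-th free module in the minimal graded free resolution of $S/I_{L(m)}$ over $S$, i.e. $\dim_K\operatorname{Tor}_i^S(S/I_{L(m)},K)$. Algebraic Scarf complex: for a nonempty finite subset $J\subseteq L$, $\max(J)$ is the coordinatewise maximum of the elements of $J$.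 Let $\Delta_L$ be the simplicial complex of finite subsets $J\subseteq L$ such that $\max(J)\ne\max(J')$ for every finite subset $J'\subseteq L$ with $J'\ne J$. The lattice $L$ acts on $\Delta_L$ by translation. The algebraic Scarf complex of $I_L$ (Peeva–Sturmfels) is a complex of free $S$-modules whose free module in homological degree $i$ has a basis indexed by the $L$-orbits of faces of $\Delta_L$ with $i+1$ elements. Its $f$-vector $(f_0,f_1,f_2)$ (numbers of vertices, edges and triangles) records the ranks in homological degrees $1,2,3$: $f_i$ is the number of $L$-orbits of faces of $\Delta_L$ with $i+2$ elements. *)

(* Defs.v *)
From mathcomp Require Import all_boot all_order all_algebra.
From mathcomp Require Import finmap mpoly.
From mathcomp Require Import classical_sets functions cardinality.

Set Implicit Arguments.
Unset Strict Implicit.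
Unset Printing Implicit Defensive.

Import Order.TTheory GRing.Theory Num.Theory.

Local Open Scope ring_scope.
Local Open Scope classical_set_scope.
Local Open Scope card_scope.

Section GeneratedIdeal.
Variable R : comNzRingType.

Definition ideal_gen (G : set R) : set R :=
  [set f | exists s : seq (R * R),
     (forall p, p \in s -> G p.2) /\ f = \sum_(p <- s) p.1 * p.2].

End GeneratedIdeal.

Section LatticeIdeal.
Variables (K : fieldType) (n : nat).

(* [absz] only casts the nonnegative integer max(u_i, 0) to nat. *)
Definition pos_part (u : 'rV[int]_n) : 'X_{1..n} :=
  [multinom absz (Num.max (u 0 i) 0)%R | i < n].

Definition neg_part (u : 'rV[int]_n) : 'X_{1..n} := pos_part (- u).

Definition lattice_ideal (L : set 'rV[int]_n) : set {mpoly K[n]} :=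
  ideal_gen [set 'X_[pos_part u] - 'X_[neg_part u] | u in L].

End LatticeIdeal.

Arguments lattice_ideal K {n} L.

Section Betti.
Variables (K : fieldType) (n : nat).
Local Notation S := {mpoly K[n]}.

Definition wdeg (w : 'I_n -> nat) (x : 'X_{1..n}) : nat :=
  (\sum_(i < n) x i * w i)%N.

(* Data of a sequence of graded free S-modules of finite rank over a cyclic
   module S/I:
     ... -> F_2 -> F_1 -> F_0 -> S/I,   F_i = (+)_j S(- gdeg i j).
   Elements of F_i are row vectors, so the maps are v |-> v *m diff i and
   v |-> class of (v *m aug) 0 0; as F_0 is free, every map F_0 -> S/I lifts
   to such a column [aug] with entries in S. *)
Record graded_free_seq := GradedFreeSeq {
  rk : nat -> nat;
  gdeg : forall i, 'I_(rk i) -> int;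
  aug : 'cV[S]_(rk 0);
  diff : forall i, 'M[S]_(rk i.+1, rk i) }.

(* The entry e of the matrix of a degree-preserving map
   S(-a) -> S(-b) is zero or homogeneous of degree a - b. *)
Definition degree_preserving (w : 'I_n -> nat) (a b : int) (e : S) : Prop :=
  forall x, x \in msupp e -> b + (wdeg w x)%:Z = a.

Definition graded (w : 'I_n -> nat) (F : graded_free_seq) : Prop :=
  (forall j, degree_preserving w (@gdeg F 0 j) 0 (aug F j 0)) /\
  (forall i j k,
     degree_preserving w (@gdeg F i.+1 j) (@gdeg F i k) (diff F i j k)).

Definition resolves (I : set S) (F : graded_free_seq) : Prop :=
  [/\ exists v : 'rV[S]_(rk F 0), I ((v *m aug F) 0 0 - 1),
      forall v : 'rV[S]_(rk F 0),
        I ((v *m aug F) 0 0) <-> exists u, v = u *m diff F 0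
    & forall i (v : 'rV[S]_(rk F i.+1)),
        v *m diff F i = 0 <-> exists u, v = u *m diff F i.+1].

(* F_{i+1} is mapped into (x_1, ..., x_n) F_i. *)
Definition minimal (F : graded_free_seq) : Prop :=
  forall i j k, (diff F i j k)@_0%MM = 0.

Definition minimal_graded_free_resolution
    (w : 'I_n -> nat) (I : set S) (F : graded_free_seq) : Prop :=
  [/\ graded w F, resolves I F & minimal F].

(* beta_i(S/I) = b: the minimal graded free resolution exists and its i-th
   module has rank b. *)
Definition betti_eq (w : 'I_n -> nat) (I : set S) (i b : nat) : Prop :=
  (exists F, minimal_graded_free_resolution w I F) /\
  (forall F, minimal_graded_free_resolution w I F -> rk F i = b).

End Betti.

Section Scarf.
Variables (n : nat) (L : set 'rV[int]_n).
Implicit Types J : {fset 'rV[int]_n}.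

(* For nonempty J, the default value of the iterated maximum is attained by
   an element of J, so this is the coordinatewise maximum of J. *)
Definition vmax J : 'rV[int]_n :=
  \row_i \big[Num.max/(head 0 (enum_fset J)) 0 i]_(u <- enum_fset J) u 0 i.

Definition scarf_complex : set {fset 'rV[int]_n} :=
  [set J | [/\ J <> fset0, [set` J] `<=` L
    & forall J', J' <> fset0 -> [set` J'] `<=` L -> J' <> J ->
        vmax J <> vmax J']].

Definition translate (u : 'rV[int]_n) J : {fset 'rV[int]_n} :=
  [fset (u + v)%R | v in J]%fset.

Definition lattice_orbit J : set {fset 'rV[int]_n} := [set translate u J | u in L].

Definition scarf_orbits (k : nat) : set (set {fset 'rV[int]_n}) :=
  [set lattice_orbit J | J in [set J | scarf_complex J /\ #|` J|%fset = k]].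

(* f_i = N for the algebraic Scarf complex of I_L *)
Definition scarf_f_eq (i N : nat) : Prop := scarf_orbits i.+2 #= `I_N.

End Scarf.

Definition row4 (a b c d : int) : 'rV[int]_4 := \row_i [:: a; b; c; d]`_i.

Definition Lgens (m : nat) : 3.-tuple 'rV[int]_4 :=
  let z := m%:Z in
  [tuple row4 (z + 4) (- (z + 1)) (- 1) (- 1);
         row4 (- (z + 1)) (- 3) (- 1) (z + 4);
         row4 (- 1) (z + 3) (- (z + 1)) (- 1)].

Definition L (m : nat) : set 'rV[int]_4 := [set u | inIntSpan (Lgens m) u].

Definition weights (m : nat) (i : 'I_4) : nat :=
  nth 0%N [:: m ^ 3 + 7 * m ^ 2 + 21 * m + 20;
              m ^ 3 + 8 * m ^ 2 + 25 * m + 25;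
              m ^ 3 + 8 * m ^ 2 + 26 * m + 25;
              m ^ 3 + 8 * m ^ 2 + 28 * m + 30]%N i.

(* Main.v *)
Require Import Defs.
From mathcomp Require Import all_boot all_order all_algebra.
From mathcomp Require Import finmap mpoly.
From mathcomp Require Import boolp classical_sets cardinality.
From mathcomp Require Import ring zify.

(* The lattice is generic: S/I_L modulo the nonzerodivisor x_4 (the variable
   with index 3 below) is K[x_1, x_2, x_3]/M for a monomial ideal M with seven
   generators, the leading terms x^{h^+} of the binomials x^{h^+} - x^{h^-},
   where h runs over the neighbors of 0 in the Scarf complex with negative last
   coordinate. Two arithmetic facts control everything: only its own vertices
   lie below the coordinatewise maximum of each of the six Scarf tetrahedra
   {0, h, h', h''}, and every nonzero u in L with nonpositive last coordinate
   satisfies h <= max(0, u) for some neighbor h. Together they determine the Scarf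
   complex, and they show that the seven binomials form a Groebner basis.
   The boundary maps of the Scarf complex are then exact by Schreyer's criterion
   for the order in which terms with a smaller exponent of x_4 come first;
   all exponents are affine in m, so the criterion reduces to finitely many
   inequalities between affine functions. Ranks of minimal resolutions are
   unique because comparison maps between two of them become mutually inverse
   matrices over K after setting all variables to 0. *)

Set Implicit Arguments.
Unset Strict Implicit.
Unset Printing Implicit Defensive.

Import Order.TTheory GRing.Theory Num.Theory.

(** * Ideals of a commutative ring *)

Section Ideals.
Local Open Scope ring_scope.

Definition is_ideal (R : comNzRingType) (I : set R) : Prop :=
  [/\ I 0, forall f g, I f -> I g -> I (f + g) & forall a f, I f -> I (a * f)].

Lemma ideal_gen_is_ideal (R : comNzRingType) (G : set R) :
  is_ideal (ideal_gen G).
Proof.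
split.
- by exists [::]; split=> //; rewrite big_nil.
- move=> f g [s [sG ->]] [t [tG ->]]; exists (s ++ t); split.
    by move=> p; rewrite mem_cat => /orP[/sG|/tG].
  by rewrite big_cat.
- move=> a f [s [sG ->]]; exists [seq (a * p.1, p.2) | p <- s]; split.
    by move=> _ /mapP[p /sG Gp ->].
  by rewrite big_map mulr_sumr; apply: eq_bigr => p _; rewrite mulrA.
Qed.

Lemma ideal_gen_mem (R : comNzRingType) (G : set R) (g : R) :
  G g -> ideal_gen G g.
Proof.
move=> Gg; exists [:: (1, g)]; split=> [p|]; first by rewrite inE => /eqP->.
by rewrite big_seq1 mul1r.
Qed.

Lemma ideal_gen_min (R : comNzRingType) (G I : set R) :
  is_ideal I -> (forall g, G g -> I g) -> forall f, ideal_gen G f -> I f.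
Proof.
move=> [I0 ID IM] GI f [s [sG ->]]; rewrite big_seq; apply: big_ind => //.
by move=> p /sG /GI; apply: IM.
Qed.

Lemma ideal_mulmx (R : comNzRingType) (I : set R) m n (A : 'M[R]_(m, n))
    (c : 'cV[R]_n) :
  is_ideal I -> (forall j, I (c j 0)) -> forall j, I ((A *m c) j 0).
Proof.
move=> [I0 ID IM] Ic j; rewrite mxE; apply: big_ind => // k _; exact: IM.
Qed.

End Ideals.

(** * Uniqueness of the ranks of minimal resolutions *)

Section RankUniqueness.
Local Open Scope ring_scope.
Variables (K : fieldType) (n : nat).
Local Notation S := {mpoly K[n]}.

Lemma factor_rows m p q (A : 'M[S]_(m, q)) (D : 'M[S]_(p, q)) :
  (forall j, exists u, row j A = u *m D) -> exists U, A = U *m D.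
Proof.
move=> /fin_all_exists[u uP]; exists (\matrix_j u j).
by apply/row_matrixP => j; rewrite row_mul rowK.
Qed.

Local Notation ev0 := (map_mx (mcoeff 0%MM : S -> K)).

(* A is homotopic to the identity in degree i; only the part of the homotopy
   needed to pass from degree i to degree i + 1 is remembered. *)
Definition near_id (F : graded_free_seq K n) i (A : 'M[S]_(rk F i)) : Prop :=
  ev0 A = 1%:M /\ exists h, diff F i *m (A - 1%:M - h *m diff F i) = 0.

Lemma diff_diff (I : set S) (F : graded_free_seq K n) i :
  resolves I F -> diff F i.+1 *m diff F i = 0.
Proof.
case=> _ _ exF; apply/row_matrixP => j; rewrite row_mul row0.
by apply/exF; exists (delta_mx 0 j); rewrite -rowE.
Qed.

Lemma exact_mx (I : set S) (F : graded_free_seq K n) i m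
    (A : 'M[S]_(m, rk F i.+1)) :
  resolves I F -> A *m diff F i = 0 -> exists U, A = U *m diff F i.+1.
Proof.
case=> _ _ exF A0; apply: factor_rows => j; apply/exF.
by rewrite -row_mul A0 row0.
Qed.

Lemma ev0_diff (F : graded_free_seq K n) i :
  minimal F -> ev0 (diff F i) = 0.
Proof. by move=> Fmin; apply/matrixP => j k; rewrite !mxE Fmin. Qed.

(** [diff F i] kills [B - 1%:M - diff F i *m h], so exactness supplies the next homotopy [h']. By
    minimality both homotopy terms vanish once all variables are set to 0. *)
Lemma near_id_next (I : set S) (F : graded_free_seq K n) i
    (A : 'M[S]_(rk F i)) (B : 'M[S]_(rk F i.+1)) :
  resolves I F -> minimal F -> near_id A ->
  B *m diff F i = diff F i *m A -> near_id B.
Proof.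
move=> resF Fmin [_ [h hP]] BA.
have [h' h'P] : exists h', B - 1%:M - diff F i *m h = h' *m diff F i.+1.
  apply: exact_mx resF _; rewrite !mulmxBl BA mul1mx.
  by rewrite -hP !mulmxBr mulmx1 mulmxA.
have eB : B = 1%:M + diff F i *m h + h' *m diff F i.+1.
  by rewrite -h'P; apply/matrixP => j k; rewrite !mxE; ring.
split.
  by rewrite eB !map_mxD !map_mxM !ev0_diff // mul0mx mulmx0 !addr0 map_mx1.
exists h'; rewrite -h'P subKr mulmxA (diff_diff _ resF) mul0mx //.
Qed.

(** The augmentation of [G] maps some [v] to 1 modulo [I]; multiples of [v] by the entries of
    [aug F] lift the basis vectors of F_0. *)
Lemma aug_lift (I : set S) (F G : graded_free_seq K n) :
  is_ideal I -> resolves I G ->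
  exists f : 'M[S]_(rk F 0, rk G 0),
    forall j, I ((f *m aug G - aug F) j 0).
Proof.
move=> [I0 ID IM] [[v v1] _ _].
exists (aug F *m v) => j.
have -> : (aug F *m v *m aug G - aug F) j 0
    = aug F j 0 * ((v *m aug G) 0 0 - 1).
  rewrite -mulmxA mxE [X in X + _]mxE big_ord1 [X in _ + X]mxE.
  by rewrite mulrBr mulr1.
exact: IM.
Qed.

Lemma near_id_aug (I : set S) (F : graded_free_seq K n) (A : 'M[S]_(rk F 0)) :
  resolves I F -> minimal F -> (forall j, I ((A *m aug F - aug F) j 0)) ->
  near_id A.
Proof.
move=> [_ ex0 _] Fmin AI.
have [h hP] : exists h, A - 1%:M = h *m diff F 0.
  apply: factor_rows => j; apply/ex0.
  move: (AI j); congr (I _).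
  rewrite -row_mul mulmxBl mul1mx [in RHS]mxE //.
split; last by exists h; rewrite hP subrr mulmx0.
have -> : A = 1%:M + h *m diff F 0 by rewrite -hP addrC subrK.
by rewrite map_mxD map_mxM ev0_diff // mulmx0 addr0 map_mx1.
Qed.

(** The maps [f'] and [g'] that complete the squares serve as the comparison maps of the next
    degree, so the induction has to carry them along. *)
Lemma comparison (I : set S) (F G : graded_free_seq K n) i :
  is_ideal I -> resolves I F -> resolves I G -> minimal F -> minimal G ->
  exists (f : 'M[S]_(rk F i, rk G i)) (g : 'M[S]_(rk G i, rk F i)),
    [/\ near_id (f *m g), near_id (g *m f),
        exists f', diff F i *m f = f' *m diff G i
      & exists g', diff G i *m g = g' *m diff F i].
Proof.
move=> idI rF rG Fmin Gmin; elim: i => [|i [f [g [fg gf [f' f'P] [g' g'P]]]]].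
  have [f fP] := aug_lift F idI rG; have [g gP] := aug_lift G idI rF.
  have lift0 F1 F2 (r1 : resolves I F1) (r2 : resolves I F2)
      (a : 'M[S]_(rk F1 0, rk F2 0)) :
      (forall j, I ((a *m aug F2 - aug F1) j 0)) ->
      exists a', diff F1 0 *m a = a' *m diff F2 0.
    move=> aP; apply: factor_rows => j.
    case: r2 => _ ex2 _; apply/ex2; rewrite row_mul.
    have -> : row j (diff F1 0) *m a *m aug F2
       = row j (diff F1 0) *m (a *m aug F2 - aug F1)
         + row j (diff F1 0) *m aug F1.
      by rewrite mulmxBr subrK mulmxA.
    rewrite mxE; case: (idI) => _ ID _; apply: ID; first exact: ideal_mulmx.
    by case: r1 => _ ex1 _; apply/ex1; exists (delta_mx 0 j); rewrite -rowE.
  have nid F1 F2 (r1 : resolves I F1) (m1 : minimal F1)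
      (a : 'M[S]_(rk F1 0, rk F2 0)) (b : 'M[S]_(rk F2 0, rk F1 0)) :
      (forall j, I ((a *m aug F2 - aug F1) j 0)) ->
      (forall j, I ((b *m aug F1 - aug F2) j 0)) -> near_id (a *m b).
    move=> aP bP; apply: near_id_aug r1 m1 _ => j.
    have -> : a *m b *m aug F1 - aug F1
        = a *m (b *m aug F1 - aug F2) + (a *m aug F2 - aug F1).
      by rewrite mulmxBr mulmxA addrA subrK.
    by rewrite mxE; case: (idI) => _ ID _; apply: ID => //; apply: ideal_mulmx.
  by exists f, g; split; [exact: nid|exact: nid|exact: lift0|exact: lift0].
exists f', g'; split.
- by apply: near_id_next rF Fmin fg _; rewrite -mulmxA -g'P !mulmxA f'P.
- by apply: near_id_next rG Gmin gf _; rewrite -mulmxA -f'P !mulmxA g'P.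
- apply: exact_mx rG _.
  by rewrite -mulmxA -f'P mulmxA (diff_diff _ rF) mul0mx.
- apply: exact_mx rF _.
  by rewrite -mulmxA -g'P mulmxA (diff_diff _ rG) mul0mx.
Qed.

Theorem minimal_resolution_rank (I : set S) (F G : graded_free_seq K n) i :
  is_ideal I -> resolves I F -> resolves I G -> minimal F -> minimal G ->
  rk F i = rk G i.
Proof.
move=> idI rF rG Fmin Gmin.
have [f [g [[fg _] [gf _] _ _]]] := comparison i idI rF rG Fmin Gmin.
rewrite map_mxM in fg; rewrite map_mxM in gf.
(* An identity matrix that factors through a free module has at most the size of that module's rank;
   this is used in both directions. *)
by apply/eqP; rewrite eqn_leq (mulmx1_min fg) (mulmx1_min gf).
Qed.

End RankUniqueness.

(** * Schreyer's criterion for exactness *)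

Section Schreyer.
Local Open Scope ring_scope.
Variables (K : fieldType) (n : nat) (o : 'I_n).
Local Notation S := {mpoly K[n]}.

(* ((s, k), b) stands for (-1)^s x^b e_k. *)
Definition term : Type := (bool * nat * 'X_{1..n})%type.

Definition shift (a : 'X_{1..n}) (t : term) : term := (t.1, (a + t.2)%MM).

Definition tvec r (t : term) : 'rV[S]_r :=
  \row_k (if t.1.2 == k :> nat then (-1) ^+ t.1.1 *: 'X_[t.2] else 0).

Definition row_vec r (l : seq term) : 'rV[S]_r := \sum_(t <- l) tvec r t.

Definition rows_mx r' r (P : seq (seq term)) : 'M[S]_(r', r) :=
  \matrix_(j < r') row_vec r (nth [::] P j).

Definition lead (l : seq term) : term := head (false, 0%N, 0%MM) l.

Local Notation lead_at P j := (lead (nth [::] P j)).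

(* The term order for which a term is larger when this number is smaller: the
   exponent of x_o is compared first, then the index, in decreasing order. *)
Definition corank r (t : term) : nat := (t.2 o * r + (r - t.1.2))%N.

Definition well_led r (l : seq term) : bool :=
  [&& l != [::], all (fun t => t.1.2 < r)%N l
    & all (fun t => corank r (lead l) < corank r t)%N (behead l)].

Definition reducible (P : seq (seq term)) (k : nat) (a : 'X_{1..n}) : bool :=
  has (fun l => ((lead l).1.2 == k) && ((lead l).2 <= a)%MM) P.

(** [deg k] is the degree of the basis vector e_k. *)
Definition homogeneous_row (w : 'I_n -> nat) (deg : nat -> nat)
    (l : seq term) : Prop :=
  forall t, t \in l ->
    (wdeg w t.2 + deg t.1.2 = wdeg w (lead l).2 + deg (lead l).1.2)%N.

Lemma corank_shift r a t : corank r (shift a t) = (a o * r + corank r t)%N.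
Proof. by rewrite /corank /= mnmDE mulnDl addnA. Qed.

Lemma wdegD (w : 'I_n -> nat) (a b : 'X_{1..n}) :
  wdeg w (a + b)%MM = (wdeg w a + wdeg w b)%N.
Proof.
by rewrite /wdeg -big_split; apply: eq_bigr => i _; rewrite mnmDE mulnDl.
Qed.

(** Bounds [corank] on the terms of a fixed degree. Division therefore terminates, although each
    step passes to terms of larger [corank]. *)
Lemma exponent_le_wdeg (w : 'I_n -> nat) (a : 'X_{1..n}) :
  (0 < w o)%N -> (a o <= wdeg w a)%N.
Proof.
move=> w0; rewrite /wdeg (bigD1 o) //=.
by apply: leq_trans (leq_addr _ _); rewrite leq_pmulr.
Qed.

Lemma tvec_shift r a t : tvec r (shift a t) = 'X_[a] *: tvec r t.
Proof.
apply/rowP => k; rewrite !mxE /=; case: eqP => _; last by rewrite mulr0.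
by rewrite mpolyXD -scalerAr.
Qed.

Lemma tvec_sign r s t :
  tvec r (s (+) t.1.1, t.1.2, t.2) = (-1) ^+ s *: tvec r t.
Proof.
apply/rowP => k; rewrite !mxE /=; case: eqP => _; last by rewrite mulr0.
case: s; last by rewrite addFb expr0 mul1r.
by rewrite addTb signrN scaleNr expr1 mulN1r.
Qed.

Lemma row_vec_mul r' r (P : seq (seq term)) (l : seq term) :
  all (fun t => t.1.2 < r')%N l ->
  row_vec r' l *m rows_mx r' r P =
    row_vec r (flatten [seq [seq (t.1.1 (+) t'.1.1, t'.1.2, (t.2 + t'.2)%MM)
                              | t' <- nth [::] P t.1.2] | t <- l]).
Proof.
move=> /allP lr; rewrite /row_vec big_flatten big_map mulmx_suml.
rewrite !big_seq; apply: eq_bigr => t /lr tr.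
have -> : tvec r' t
    = ((-1) ^+ t.1.1 *: 'X_[t.2] : S) *: delta_mx 0 (Ordinal tr).
  apply/rowP => k; rewrite !mxE eqxx /= -val_eqE /= eq_sym.
  by case: eqP => _; rewrite ?mulr1 ?mulr0.
rewrite -scalemxAl -rowE rowK /= big_map /row_vec scaler_sumr.
apply: eq_bigr => t' _.
rewrite (tvec_sign r t.1.1 (shift t.2 t')) tvec_shift scalerA; congr (_ *: _).
by case: (t.1.1); rewrite ?expr0 ?expr1 ?scale1r ?mul1r // scaleN1r mulN1r.
Qed.

(** Terms of opposite sign are matched one to one, so the check is purely combinatorial and holds
    over every field. *)
Lemma row_vec_cancel r (l : seq term) :
  perm_eq [seq (t.1.2, t.2) | t <- l & t.1.1]
          [seq (t.1.2, t.2) | t <- l & ~~ t.1.1] ->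
  row_vec r l = 0.
Proof.
move=> lP.
pose f (x : nat * 'X_{1..n}) := tvec r (false, x.1, x.2).
have fE (t : term) :
    tvec r t = (if t.1.1 then - f (t.1.2, t.2) else f (t.1.2, t.2)).
  case: t => [[[] k] b]; apply/rowP => i; rewrite !mxE //=.
  by case: eqP; rewrite ?oppr0 // expr1 scaleN1r scale1r.
rewrite /row_vec (bigID (fun t : term => t.1.1)) /=.
rewrite (eq_bigr (fun t : term => - f (t.1.2, t.2))); last first.
  by move=> t ht; rewrite fE ht.
rewrite [X in _ + X](eq_bigr (fun t : term => f (t.1.2, t.2))); last first.
  by move=> t /negPf ht; rewrite fE ht.
have fold (p : pred term) : \sum_(t <- l | p t) f (t.1.2, t.2) =
    \sum_(x <- [seq (t.1.2, t.2) | t <- l & p t]) f x.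
  by rewrite big_map big_filter.
by rewrite sumrN !fold (perm_big _ lP) addNr.
Qed.

Definition supported r (N : nat -> 'X_{1..n} -> bool) (v : 'rV[S]_r) : Prop :=
  forall (k : 'I_r) a, ~~ N k a -> (v 0 k)@_a = 0.

(** * Division with remainder by homogeneous rows *)

Section Reduction.
Variables (r' r : nat) (P : seq (seq term)).
Variables (w : 'I_n -> nat) (deg : nat -> nat).
Hypotheses (w_gt0 : (0 < w o)%N) (size_P : size P = r').
Hypotheses (led_P : all (well_led r) P)
  (hom_P : forall l, l \in P -> homogeneous_row w deg l).

Let D := rows_mx r' r P.
Let reduces (v : 'rV[S]_r) := exists (u : 'rV[S]_r') v',
  v = u *m D + v' /\ supported (fun k a => ~~ reducible P k a) v'.

Let reduces_im u : reduces (u *m D).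
Proof.
by exists u, 0; rewrite addr0; split=> // k a _; rewrite mxE mcoeff0.
Qed.

Let reducesD v1 v2 : reduces v1 -> reduces v2 -> reduces (v1 + v2).
Proof.
move=> [u1 [w1 [-> s1]]] [u2 [w2 [-> s2]]]; exists (u1 + u2), (w1 + w2).
split; first by rewrite mulmxDl addrACA.
by move=> k a ka; rewrite mxE mcoeffD s1 // s2 // addr0.
Qed.

Let reducesZ (c : K) v : reduces v -> reduces (c%:MP *: v).
Proof.
move=> [u [w1 [-> s]]]; exists (c%:MP *: u), (c%:MP *: w1).
split; first by rewrite scalerDr scalemxAl.
by move=> k a ka; rewrite mxE mcoeffCM s // mulr0.
Qed.

Let reduces_sum (T : eqType) (s : seq T) (F : T -> 'rV[S]_r) :
  (forall x, x \in s -> reduces (F x)) -> reduces (\sum_(x <- s) F x).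
Proof.
move=> sF; rewrite big_seq; apply: big_ind => //.
by rewrite -(mul0mx _ D); exact: reduces_im.
Qed.

Let corank_bound (t : term) :
  (corank r t <= (wdeg w t.2 + deg t.1.2) * r + r)%N.
Proof.
rewrite /corank leq_add ?leq_subr // leq_mul2r.
by rewrite (leq_trans (exponent_le_wdeg t.2 w_gt0)) ?leq_addr ?orbT.
Qed.

Let reduces_term t : (t.1.2 < r)%N -> reduces (tvec r t).
Proof.
(* Induction on the gap between [corank] and [corank_bound]: subtracting a multiple of a row keeps
   the degree, hence the bound, and leaves only terms of larger [corank]. *)
have [N] := ubnP ((wdeg w t.2 + deg t.1.2) * r + r - corank r t)%N.
elim: N t => // N IH [[s k] a] /= ltN ltkr.
have [/hasP[l lP /andP[/eqP lk la]]|na] := boolP (reducible P k a); last first.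
  exists 0, (tvec r (s, k, a)); split; first by rewrite mul0mx add0r.
  move=> i b; rewrite negbK mxE /= => ib.
  case: eqP => [ki|_]; last by rewrite mcoeff0.
  rewrite mcoeffZ mcoeffX; case: eqP => [ab|_]; last by rewrite mulr0.
  by rewrite ki ab ib in na.
have /and3P[l0 lr ltl] := allP led_P _ lP.
have hl := hom_P lP.
have [t0 [l' el]] : exists (t0 : term) (l' : seq term), l = t0 :: l'.
  by move: (l : seq term) l0 => [|t0 l'] // _; exists t0, l'.
rewrite el /= in lk la lr ltl hl; case/andP: lr => t0r l'r.
have jr : (index l P < r')%N by rewrite -size_P index_mem.
have imP : reduces ('X_[a - t0.2] *: row_vec r l).
  have -> : row_vec r l = row (Ordinal jr) D by rewrite rowK /= nth_index.
  by rewrite rowE scalemxAl; exact: reduces_im.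
have tail t1 : t1 \in l' -> reduces ('X_[a - t0.2] *: tvec r t1).
  move=> t1l; rewrite -tvec_shift.
  apply: IH => /=; last exact: (allP l'r _ t1l).
  have := allP ltl _ t1l; have := hl t1; rewrite inE t1l orbT => /(_ isT).
  have := corank_bound (shift (a - t0.2) t1).
  rewrite corank_shift /= wdegD => Hb Hh Hc.
  have ec : corank r (s, k, a) = ((a - t0.2)%MM o * r + corank r t0)%N.
    by rewrite -corank_shift /corank /= submK // lk.
  have eW : wdeg w a = (wdeg w (a - t0.2) + wdeg w t0.2)%N.
    by rewrite -wdegD submK.
  move: ltN; rewrite ec eW -lk => ltN.
  have eW2 : (wdeg w (a - t0.2) + wdeg w t1.2 + deg t1.1.2 =
    wdeg w (a - t0.2) + wdeg w t0.2 + deg t0.1.2)%N by rewrite -!addnA Hh.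
  rewrite eW2 in Hb *.
  set A := ((_ + _) * r)%N in Hb ltN *; set B := (_ * r)%N in Hb ltN *.
  by lia.
(* The row is solved for its leading term; the scalar reconciles the signs of the two terms. *)
have -> : tvec r (s, k, a) = ((-1) ^+ (s (+) t0.1.1))%:MP *:
    ('X_[a - t0.2] *: row_vec r l
      + (-1)%:MP *: \sum_(t1 <- l') 'X_[a - t0.2] *: tvec r t1).
  rewrite -scaler_sumr el /row_vec big_cons [in X in _ *: (X + _)]scalerDr.
  rewrite mpolyCN mpolyC1 scaleN1r addrK.
  rewrite -tvec_shift; apply/rowP => i; rewrite !mxE /= submK // lk.
  case: eqP => _; rewrite ?mulr0 // mul_mpolyC scalerA -signr_addb.
  by rewrite -addbA addbb addbF.
by apply/reducesZ/reducesD => //; apply/reducesZ/reduces_sum.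
Qed.

Lemma reduction (v : 'rV[S]_r) : exists (u : 'rV[S]_r') v',
  v = u *m D + v' /\ supported (fun k a => ~~ reducible P k a) v'.
Proof.
have -> : v = \sum_k \sum_(a <- msupp (v 0 k))
    ((v 0 k)@_a)%:MP *: tvec r (false, nat_of_ord k, a).
  rewrite {1}[v]matrix_sum_delta big_ord1; apply: eq_bigr => k _.
  rewrite {1}[v 0 k]mpolyE scaler_suml; apply: eq_bigr => a _.
  apply/rowP => i; rewrite !mxE eqxx /= val_eqE eq_sym expr0 scale1r.
  by case: eqP => _; rewrite ?mulr1 ?mulr0 // mul_mpolyC.
apply: reduces_sum => k _; apply: reduces_sum => a _.
by apply/reducesZ/reduces_term => /=.
Qed.

End Reduction.

Lemma mcoeffMX_if (p : S) (b c : 'X_{1..n}) :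
  (p * 'X_[b])@_c = if (b <= c)%MM then p@_(c - b) else 0.
Proof.
case: ifPn => [bc|nbc]; first by rewrite -{1}(submK bc) addmC mcoeffMX.
apply/eqP; rewrite mcoeff_eq0 (perm_mem (msuppMX p b)).
apply: contra nbc => /mapP[a _ ->].
by apply/mnm_lepP => i; rewrite mnmDE leq_addr.
Qed.

(* Terms of v have pairwise distinct leading terms in v *m rows_mx P. *)
Lemma kernel_supported r' r (P : seq (seq term)) (N : nat -> 'X_{1..n} -> bool)
    (v : 'rV[S]_r') :
  size P = r' -> all (well_led r) P ->
  (forall j' j a, (j' < j < r')%N -> (lead_at P j').1.2 = (lead_at P j).1.2 ->
     N j a -> ~~ ((lead_at P j').2 <= a + (lead_at P j).2)%MM) ->
  supported N v -> v *m rows_mx r' r P = 0 -> v = 0.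
Proof.
move=> sP led distinct vN vP.
(* The coefficients of [v] are shown to vanish in the order of increasing [corank] of the leading
   term that they produce in the product. *)
suff v0 d (j : 'I_r') a :
    (corank r (shift a (lead_at P j)) < d)%N -> (v 0 j)@_a = 0.
  apply/rowP => j; rewrite mxE; apply/mpolyP => a; rewrite mcoeff0.
  exact: (v0 _ j a (ltnSn _)).
elim: d j a => // d IH j a; rewrite ltnS => ltd.
have [Nja|Nja] := boolP (N j a); last exact: vN.
have jP : nth [::] P j \in P by rewrite mem_nth ?sP.
have /and3P[] := allP led _ jP.
set l := nth [::] P j in ltd *.
case el : l => [//|t0 l'] _ /= /andP[t0r l'r] ltl.
rewrite el /= in ltd.
(* The vanishing of the product is read off at this leading term: component [k], exponent [c]. All
   summands but the coefficient of [v] at [a] will drop out. *)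
pose k := Ordinal t0r; pose c := (a + t0.2)%MM.
have := congr1 (fun u : 'rV[S]_r => (u 0 k)@_c) vP.
rewrite !mxE mcoeff0 raddf_sum /= (bigD1 j) //=.
have entryE (i : 'I_r') : (v 0 i * rows_mx r' r P i k)@_c =
    \sum_(t <- nth [::] P i) (if (t.1.2 == k :> nat) && (t.2 <= c)%MM
        then (-1) ^+ t.1.1 * (v 0 i)@_(c - t.2) else 0).
  rewrite mxE /row_vec summxE mulr_sumr raddf_sum; apply: eq_bigr => t _ /=.
  rewrite mxE; case: eqP => _ /=; last by rewrite mulr0 mcoeff0.
  by rewrite -scalerAr mcoeffZ mcoeffMX_if; case: ifP; rewrite ?mulr0.
(* If a tail term reaches [c], the leading term of the same multiple has smaller [corank], so the
   coefficient of [v] in front of it vanishes by induction. *)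
have tail0 (i : 'I_r') t : t \in behead (nth [::] P i) ->
    (if (t.1.2 == k :> nat) && (t.2 <= c)%MM
        then (-1) ^+ t.1.1 * (v 0 i)@_(c - t.2) else 0) = 0.
  move=> tl; case: ifP => // /andP[/eqP tk tc].
  rewrite IH ?mulr0 //; apply: leq_trans ltd.
  have iP : nth [::] P i \in P by rewrite mem_nth ?sP.
  have /and3P[_ _ /allP/(_ _ tl)] := allP led _ iP.
  have -> : corank r (shift a t0) = corank r (shift (c - t.2) t).
    by rewrite /corank /= submK // tk.
  by rewrite !corank_shift ltn_add2l.
rewrite entryE -/l el big_cons eqxx /=.
have -> : (t0.2 <= c)%MM by apply/mnm_lepP => i; rewrite mnmDE leq_addl.
have -> : (c - t0.2)%MM = a by rewrite addmK.
rewrite big_seq big1 => [|t tl']; last first.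
  by apply: (tail0 j); rewrite -/l el.
rewrite big1 => [|i ij]; last first.
  rewrite entryE; have iP : nth [::] P i \in P by rewrite mem_nth ?sP.
  have /and3P[] := allP led _ iP.
  case ei : (nth [::] P i) => [//|t1 l1] _ _ _; rewrite big_cons.
  rewrite big_seq big1 => [|t tl]; last by apply: (tail0 i); rewrite ei.
  rewrite addr0; case: ifP => // /andP[/eqP tk tc].
  have [Ni|Ni] := boolP (N i (c - t1.2)%MM); last by rewrite vN // mulr0.
  (* Two leading terms meet at [c]. [distinct] is applied to the row with the larger index, whose
     allowed monomials avoid the earlier leading terms. *)
  move: ij; rewrite neq_ltn => /orP[ij|ji]; last first.
    have := distinct j i (c - t1.2)%MM; rewrite ji ltn_ord -/l el ei /=.
    move=> /(_ isT (esym tk) Ni); rewrite submK // => /negP[].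
    by apply/mnm_lepP => x; rewrite mnmDE leq_addl.
  have := distinct i j a; rewrite ij ltn_ord -/l el ei /=.
  by move=> /(_ isT tk Nja) /negP[].
rewrite !addr0; case: (t0.1.1); rewrite ?expr0 ?mul1r // expr1 mulN1r.
by move/eqP; rewrite oppr_eq0 => /eqP.
Qed.

(** The truncated difference of exponents generates the colon ideal of the leading monomial of row
    [j'] by that of row [j]. Leading terms in different components never meet. *)
Definition schreyer_covers (P Q : seq (seq term)) : Prop :=
  forall j' j, (j' < j < size P)%N ->
    (lead_at P j').1.2 = (lead_at P j).1.2 ->
    reducible Q j ((lead_at P j').2 - (lead_at P j).2)%MM.

(* Schreyer's criterion: the generators of the monomial ideals
   (e_0, ..., e_(j-1)) : e_j all occur as leading terms of Q. *)
Theorem schreyer_exact r'' r' r (P Q : seq (seq term)) (w : 'I_n -> nat)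
    (deg : nat -> nat) :
  (0 < w o)%N -> size P = r' -> size Q = r'' ->
  all (well_led r) P -> all (well_led r') Q ->
  (forall l, l \in Q -> homogeneous_row w deg l) ->
  schreyer_covers P Q -> rows_mx r'' r' Q *m rows_mx r' r P = 0 ->
  forall v : 'rV[S]_r',
    v *m rows_mx r' r P = 0 <-> exists u, v = u *m rows_mx r'' r' Q.
Proof.
move=> w0 sP sQ ledP ledQ homQ cover QP0 v; split; last first.
  by case=> u ->; rewrite -mulmxA QP0 mulmx0.
(* Dividing by [Q] leaves a remainder [v'] that is still in the kernel of [P], but has only
   monomials to which [kernel_supported] applies. *)
have [u [v' [-> v'N]]] := reduction w0 sQ ledQ homQ v.
rewrite mulmxDl -mulmxA QP0 mulmx0 add0r => v'P.
exists u; rewrite (kernel_supported sP ledP _ v'N v'P) ?addr0 //.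
move=> j' j a; rewrite -sP => jj ejj; apply: contra => j'a.
have /hasP[l lQ /andP[lj le]] := cover _ _ jj ejj.
apply/hasP; exists l => //; rewrite lj /=; apply: lepm_trans le _.
by apply/mnm_lepP => i; rewrite mnmBE leq_subLR addnC -mnmDE; exact/mnm_lepP.
Qed.

End Schreyer.

(** * Lattice points below the Scarf simplices *)

Section LatticePoints.
Local Open Scope ring_scope.

(* (c, d) stands for c + d m. *)
Definition lin : Type := (int * int)%type.
Definition lval (m : nat) (x : lin) : int := x.1 + x.2 * m%:Z.
(* Comparison for all m >= 1. *)
Definition lle (x y : lin) : bool := (x.2 <= y.2) && (x.1 + x.2 <= y.1 + y.2).
Definition llt (x y : lin) : bool := (x.2 <= y.2) && (x.1 + x.2 < y.1 + y.2).

Definition lvec (m : nat) (s : seq lin) : 'rV[int]_4 :=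
  \row_i lval m (nth (0, 0) s i).

(** The coordinates, affine in m, of the combination of the three vectors of [Lgens] with
    coefficients p, q, r. *)
Definition lat_sym (c : int * int * int) : seq lin :=
  let: (p, q, r) := c in
  [:: (4 * p - q - r, p - q); (- p - 3 * q + 3 * r, r - p);
      (- p - q - r, - r); (- p + 4 * q - r, q)].

Definition sym_at (c : int * int * int) (s : nat) : lin :=
  nth (0, 0) (lat_sym c) s.

Definition lat_pt (m : nat) (c : int * int * int) : 'rV[int]_4 :=
  lvec m (lat_sym c).

(* The neighbors h of 0 with h_4 < 0, in coordinates with respect to Lgens. A
   face with topmost vertex 0 is given by the indices of its other vertices. *)
Definition nbr_coef : seq (int * int * int) :=
  [:: (-1, -1, -2); (-1, -1, -1); (0, -1, -1); (0, -1, 0); (0, 0, 1);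
      (1, 0, 1); (1, 0, 0)].

Definition tris : seq (seq nat) :=
  [:: [:: 0; 1; 2]; [:: 1; 2; 3]; [:: 1; 3; 4]; [:: 2; 3; 5]; [:: 3; 4; 5];
      [:: 2; 5; 6]]%N.

Definition face_coef (A : seq nat) : seq (int * int * int) :=
  (0, 0, 0) :: [seq nth (0, 0, 0) nbr_coef i | i <- A].

Section Fixed_m.
Variables (m : nat) (m_gt0 : (0 < m)%N).

(** Writing m = 1 + (m - 1) splits the comparison into the values at 1 and the slopes. *)
Lemma lval_lle x y : lle x y -> lval m x <= lval m y.
Proof. by case: x y => [a b] [c d] /andP[/=]; rewrite /lval /=; nia. Qed.

Lemma lval_llt x y : llt x y -> lval m x < lval m y.
Proof. by case: x y => [a b] [c d] /andP[/=]; rewrite /lval /=; nia. Qed.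

Lemma L_lat_pt v : L m v <-> exists c, v = lat_pt m c.
Proof.
have E p q r : lat_pt m (p, q, r) =
    row4 (m%:Z + 4) (- (m%:Z + 1)) (- 1) (- 1) *~ p +
    row4 (- (m%:Z + 1)) (- 3) (- 1) (m%:Z + 4) *~ q +
    row4 (- 1) (m%:Z + 3) (- (m%:Z + 1)) (- 1) *~ r.
  apply/rowP => -[[|[|[|[|//]]]] i4];
    rewrite -!scaler_int !mxE !intz /lval /=; ring.
split.
  move=> [a ->]; exists (a 0, a 1, a 2%:R).
  rewrite E !big_ord_recr big_ord0 /= add0r.
  by congr (_ *~ a _ + _ *~ a _ + _ *~ a _); apply/val_inj.
move=> [[[p q] r] ->].
exists [ffun i : 'I_3 => nth 0 [:: p; q; r] i].
by rewrite E !big_ord_recr big_ord0 /= add0r !ffunE.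
Qed.

(* The multipliers are 2 x 2 minors of the matrix of the inequalities. *)
Lemma simplex_bound (p q r : int) :
  (m%:Z + 4) * p - (m%:Z + 1) * q - r <= m%:Z + 4 ->
  - (m%:Z + 1) * p - 3 * q + (m%:Z + 3) * r <= m%:Z + 3 ->
  - p - q - (m%:Z + 1) * r <= 2 * m%:Z + 4 ->
  - p + (m%:Z + 4) * q - r <= 0 ->
  [/\ -3 <= p <= 1, -3 <= q <= 0 & -2 <= r <= 2].
Proof.
have : 1 <= m%:Z by lia.
move: (m%:Z) => z z1 h1 h2 h3 h4.
have bound (D E x k : int) : 0 < D -> D * x <= E -> E < (k + 1) * D -> x <= k.
  by move=> D0 DE Ek; nia.
(* [D1] to [D4] are the weights n_1 to n_4, which up to sign are the 3 x 3 minors of the matrix of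
   the inequalities. Eliminating two unknowns from three inequalities leaves such a minor as the
   coefficient of the third unknown. *)
pose D1 := z ^+ 3 + 7 * z ^+ 2 + 21 * z + 20.
pose D2 := z ^+ 3 + 8 * z ^+ 2 + 25 * z + 25.
pose D3 := z ^+ 3 + 8 * z ^+ 2 + 26 * z + 25.
pose D4 := z ^+ 3 + 8 * z ^+ 2 + 28 * z + 30.
have z2 : z <= z ^+ 2 by rewrite expr2; nia.
have z3 : z ^+ 2 <= z ^+ 3 by rewrite [z ^+ 3]exprS; nia.
have le_mul (l a b : int) : 0 <= l -> a <= b -> l * a <= l * b.
  by move=> ? ?; exact: ler_wpM2l.
have p_hi : p <= 1.
  apply: (bound D3 (z ^+ 3 + 13 * z ^+ 2 + 48 * z + 51)).
  - by rewrite /D3; lia.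
  - have l1 : 0 <= z ^+ 2 + 7 * z + 9 by lia.
    have l2 : 0 <= 2 * z + 5 by lia.
    have l4 : 0 <= z ^+ 2 + 4 * z + 6 by lia.
    move: (le_mul _ _ _ l1 h1) (le_mul _ _ _ l2 h2) (le_mul _ _ _ l4 h4).
    rewrite /D3; lia.
  - by rewrite /D3; lia.
have p_lo : - p <= 3.
  apply: (bound D1 (3 * z ^+ 3 + 26 * z ^+ 2 + 66 * z + 51)).
  - by rewrite /D1; lia.
  - have l2 : 0 <= z ^+ 2 + 5 * z + 5 by lia.
    have l3 : 0 <= z ^+ 2 + 7 * z + 9 by lia.
    have l4 : 0 <= 4 * z + 6 by lia.
    move: (le_mul _ _ _ l2 h2) (le_mul _ _ _ l3 h3) (le_mul _ _ _ l4 h4).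
    rewrite /D1; lia.
  - by rewrite /D1; lia.
have q_hi : q <= 0.
  apply: (bound D3 (3 * z ^+ 2 + 20 * z + 31)).
  - by rewrite /D3; lia.
  - have l1 : 0 <= 2 * z + 4 by lia.
    have l2 : 0 <= z + 5 by lia.
    have l4 : 0 <= z ^+ 2 + 6 * z + 11 by lia.
    move: (le_mul _ _ _ l1 h1) (le_mul _ _ _ l2 h2) (le_mul _ _ _ l4 h4).
    rewrite /D3; lia.
  - by rewrite /D3; lia.
have q_lo : - q <= 3.
  apply: (bound D4 (4 * z ^+ 3 + 31 * z ^+ 2 + 82 * z + 75)).
  - by rewrite /D4; lia.
  - have l1 : 0 <= z ^+ 2 + 3 * z + 4 by lia.
    have l2 : 0 <= z ^+ 2 + 5 * z + 5 by lia.
    have l3 : 0 <= z ^+ 2 + 6 * z + 11 by lia.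
    move: (le_mul _ _ _ l1 h1) (le_mul _ _ _ l2 h2) (le_mul _ _ _ l3 h3).
    rewrite /D4; lia.
  - by rewrite /D4; lia.
have r_hi : r <= 2.
  apply: (bound D3 (2 * z ^+ 3 + 19 * z ^+ 2 + 63 * z + 73)).
  - by rewrite /D3; lia.
  - have l1 : 0 <= z ^+ 2 + 5 * z + 7 by lia.
    have l2 : 0 <= z ^+ 2 + 7 * z + 15 by lia.
    have l4 : 0 <= z ^+ 2 + 5 * z + 13 by lia.
    move: (le_mul _ _ _ l1 h1) (le_mul _ _ _ l2 h2) (le_mul _ _ _ l4 h4).
    rewrite /D3; lia.
  - by rewrite /D3; lia.
have r_lo : - r <= 2.
  apply: (bound D2 (2 * z ^+ 3 + 19 * z ^+ 2 + 67 * z + 80)).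
  - by rewrite /D2; lia.
  - have l1 : 0 <= z + 5 by lia.
    have l3 : 0 <= z ^+ 2 + 7 * z + 15 by lia.
    have l4 : 0 <= 2 * z + 5 by lia.
    move: (le_mul _ _ _ l1 h1) (le_mul _ _ _ l3 h3) (le_mul _ _ _ l4 h4).
    rewrite /D2; lia.
  - by rewrite /D2; lia.
by split; lia.
Qed.

Lemma lat_ptE c (s : 'I_4) : lat_pt m c 0 s = lval m (sym_at c s).
Proof. by rewrite mxE. Qed.

Let coef_box : seq (int * int * int) :=
  [seq (pq, r) | pq <- [seq (p, q) | p <- [:: -3; -2; -1; 0; 1],
     q <- [:: -3; -2; -1; 0]], r <- [:: -2; -1; 0; 1; 2]].

(** The bounds confine [c] to a box of 100 points that does not depend on m. Each point of the box
    that is not a vertex exceeds all vertices in some coordinate, for all m >= 1 at once. *)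
Lemma mem_face_coef T c : T \in tris ->
  (forall s : 'I_4, exists2 c', c' \in face_coef T
     & lat_pt m c 0 s <= lat_pt m c' 0 s) ->
  c \in face_coef T.
Proof.
move=> TP cT.
(* [B] dominates the vertices of all six tetrahedra, so that one box serves them all. *)
pose B : seq lin := [:: (4, 1); (3, 1); (4, 2); (0, 0)].
have cB (s : 'I_4) : lval m (sym_at c s) <= lval m (nth (0, 0) B s).
  have [c' c'T] := cT s; rewrite !lat_ptE => /le_trans; apply.
  have : all (fun T => all (fun c' => all (fun s => lle (sym_at c' s)
      (nth (0, 0) B s)) (iota 0 4)) (face_coef T)) tris by vm_compute.
  move=> /allP/(_ _ TP)/allP/(_ _ c'T)/allP/(_ s).
  by rewrite mem_iota ltn_ord => /(_ isT)/lval_lle.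
have cbox : c \in coef_box.
  case: c cB {cT} => [[p q] r] cB.
  have [||||hp hq hr] := @simplex_bound p q r.
  - by have := cB (inord 0); rewrite /lval /sym_at inordK //=; lia.
  - by have := cB (inord 1); rewrite /lval /sym_at inordK //=; lia.
  - by have := cB (inord 2); rewrite /lval /sym_at inordK //=; lia.
  - by have := cB (inord 3); rewrite /lval /sym_at inordK //=; lia.
  apply/allpairsP; exists ((p, q), r); split=> //.
    apply/allpairsP; exists (p, q); split=> //; rewrite !inE /=.
      by move: hp; clear; lia.
    by move: hq; clear; lia.
  by rewrite !inE /=; move: hr; clear; lia.
have : all (fun T => all (fun c => (c \in face_coef T) || has (fun s =>
    all (fun c' => llt (sym_at c' s) (sym_at c s)) (face_coef T)) (iota 0 4))
  coef_box) tris by vm_compute.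
move=> /allP chk; have {chk} /allP chk := chk _ TP.
have {chk} /orP[//|/hasP[s]] := chk _ cbox.
rewrite mem_iota => s4 /allP cs.
have [c' c'T] := cT (Ordinal s4); rewrite !lat_ptE leNgt => /negP[].
exact/lval_llt/cs.
Qed.

(** Either the monomial with exponents a, b, c is divisible by one of the seven generators of M, or
    it lies below the coordinatewise maximum of one of the six tetrahedra. The alternatives are in
    the order of [nbr_coef] and [tris]. *)
Lemma staircase (a b c : int) : 0 <= a -> 0 <= b -> 0 <= c ->
  let z := m%:Z in
  [|| 2 * z + 4 <= c, (1 <= b) && (z + 3 <= c), (z + 2 <= a) && (z + 2 <= c),
      [&& z + 1 <= a, 3 <= b & 1 <= c], z + 3 <= b, (z + 3 <= a) && (2 <= b)
    | z + 4 <= a] ||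
  [|| [&& a <= z + 2, b <= 1 & c <= 2 * z + 4],
      [&& a <= z + 2, b <= 3 & c <= z + 3],
      [&& a <= z + 1, b <= z + 3 & c <= z + 3],
      [&& a <= z + 3, b <= 3 & c <= z + 2],
      [&& a <= z + 3, b <= z + 3 & c <= 1]
    | [&& a <= z + 4, b <= 2 & c <= z + 2]].
Proof. by move=> a0 b0 c0 /=; lia. Qed.

Lemma mem_face_coef_bound T (b : seq lin) c : T \in tris ->
  all (fun s => has (fun c' => lle (nth (0, 0) b s) (sym_at c' s))
    (face_coef T)) (iota 0 4) ->
  (forall s : 'I_4, lat_pt m c 0 s <= lval m (nth (0, 0) b s)) ->
  c \in face_coef T.
Proof.
move=> TP /allP bT cb; apply: mem_face_coef TP _ => s.
have /hasP[c' c'T le_bc'] := bT s (ltac:(by rewrite mem_iota ltn_ord)).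
exists c' => //; apply: le_trans (cb s) _.
by rewrite lat_ptE; exact: lval_lle.
Qed.

Lemma forall_I4 (P : 'I_4 -> Prop) :
  P (inord 0) -> P (inord 1) -> P (inord 2) -> P (inord 3) -> forall s, P s.
Proof.
move=> P0 P1 P2 P3 s; rewrite -(inord_val s).
by case: s => -[|[|[|[|]]]].
Qed.

Definition nbr (i : nat) : int * int * int := nth (0, 0, 0) nbr_coef i.

(** [staircase] is applied to the first three coordinates of max(0, u). In the divisible case the
    generator gives the neighbor; otherwise u itself lies below the maximum of a tetrahedron, hence
    is one of its nonzero vertices. *)
Lemma exists_nbr_le c : lat_pt m c != 0 -> lat_pt m c 0 (inord 3) <= 0 ->
  exists2 i, (i < 7)%N
    & forall s, lat_pt m (nbr i) 0 s <= Num.max 0 (lat_pt m c 0 s).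
Proof.
move=> c0 c3; set v := lat_pt m c 0.
have inT T b : T \in tris ->
    all (fun s => has (fun c' => lle (nth (0, 0) b s) (sym_at c' s))
      (face_coef T)) (iota 0 4) ->
    (forall s : 'I_4, v s <= lval m (nth (0, 0) b s)) ->
    exists2 i, (i < 7)%N & forall s, lat_pt m (nbr i) 0 s <= Num.max 0 (v s).
  move=> TP bT vb; have := mem_face_coef_bound TP bT vb.
  rewrite inE => /orP[/eqP ec|/mapP[i iT ci]].
    case/eqP: c0; rewrite ec; apply/rowP => s; rewrite !mxE /lval.
    by case: s => -[|[|[|[|]]]].
  exists i; last by move=> s; rewrite /v ci le_max lexx orbT.
  have /allP/(_ _ TP)/allP/(_ _ iT) // :
    all (fun T => all (fun i => i < 7)%N T) tris by vm_compute.
have nonneg s : 0 <= Num.max 0 (v s) by rewrite le_max lexx.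
have v_le s b : Num.max 0 (v s) <= b -> v s <= b.
  by move/(le_trans _); apply; rewrite le_max lexx orbT.
have := staircase (nonneg (inord 0)) (nonneg (inord 1)) (nonneg (inord 2)).
rewrite /=; set z := m%:Z => /orP[].
  have wit i : (i < 7)%N ->
      lat_pt m (nbr i) 0 (inord 0) <= Num.max 0 (v (inord 0)) ->
      lat_pt m (nbr i) 0 (inord 1) <= Num.max 0 (v (inord 1)) ->
      lat_pt m (nbr i) 0 (inord 2) <= Num.max 0 (v (inord 2)) ->
      lat_pt m (nbr i) 0 (inord 3) <= 0 ->
      exists2 i, (i < 7)%N & forall s, lat_pt m (nbr i) 0 s <= Num.max 0 (v s).
    move=> i7 h0 h1 h2 h3; exists i => //.
    by apply: forall_I4 => //; exact: le_trans h3 _.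
  by case/or4P => [h|h|h|/or4P[h|h|h|h]];
    [apply: (wit 0%N)|apply: (wit 1%N)|apply: (wit 2%N)|apply: (wit 3%N)
    |apply: (wit 4%N)|apply: (wit 5%N)|apply: (wit 6%N)];
    rewrite ?mxE /lval ?inordK //= -/z; lia.
have box T b0 b1 b2 : T \in tris ->
    all (fun s => has (fun c' =>
        lle (nth (0, 0) [:: b0; b1; b2; (0, 0)] s) (sym_at c' s))
      (face_coef T)) (iota 0 4) ->
    [&& Num.max 0 (v (inord 0)) <= lval m b0,
        Num.max 0 (v (inord 1)) <= lval m b1
      & Num.max 0 (v (inord 2)) <= lval m b2] ->
    exists2 i, (i < 7)%N & forall s, lat_pt m (nbr i) 0 s <= Num.max 0 (v s).
  move=> TP bT /and3P[h0 h1 h2]; apply: inT TP bT _.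
  by apply: forall_I4; rewrite inordK //=; exact: v_le.
(* The constants are the coordinatewise maxima of the tetrahedra; the fourth coordinate is 0 since 0
   is the topmost vertex. *)
by case/or4P => [h|h|h|/or3P[h|h|h]];
  [apply: (box [:: 0; 1; 2]%N (2, 1) (1, 0) (4, 2))
  |apply: (box [:: 1; 2; 3]%N (2, 1) (3, 0) (3, 1))
  |apply: (box [:: 1; 3; 4]%N (1, 1) (3, 1) (3, 1))
  |apply: (box [:: 2; 3; 5]%N (3, 1) (3, 0) (2, 1))
  |apply: (box [:: 3; 4; 5]%N (3, 1) (3, 1) (1, 0))
  |apply: (box [:: 2; 5; 6]%N (4, 1) (2, 0) (2, 1))] => //;
  rewrite /lval /= -/z; lia.
Qed.

End Fixed_m.
End LatticePoints.

(** * Scarf complexes *)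

Section ScarfGeneral.
Local Open Scope fset_scope.
Local Open Scope ring_scope.
Variables (n : nat) (L : set 'rV[int]_n).
Hypotheses (L0 : L 0) (LB : forall u v, L u -> L v -> L (u - v)).
Implicit Types J : {fset 'rV[int]_n}.

Let LD u v : L u -> L v -> L (u + v).
Proof. by move=> Lu Lv; rewrite -[v]opprK -[- v]add0r; apply/LB/LB. Qed.

Lemma vmax_ge J v i : v \in J -> v 0 i <= vmax J 0 i.
Proof.
move=> vJ; have {vJ} : v \in enum_fset J by [].
rewrite mxE; move: (head 0 (enum_fset J) 0 i) => x0.
elim: (enum_fset J) x0 => // w s IH x0.
rewrite inE big_cons le_max.
by case/orP=> [/eqP->|/IH->]; rewrite ?lexx ?orbT.
Qed.

Lemma vmax_attained J i : J <> fset0 ->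
  exists2 v, v \in J & vmax J 0 i = v 0 i.
Proof.
move=> /eqP/fset0Pn[v0 v0J].
have {v0J} : v0 \in enum_fset J by [].
suff H (s : seq 'rV[int]_n) x0 : \big[Num.max/x0]_(u <- s) u 0 i = x0 \/
    exists2 v, v \in s & \big[Num.max/x0]_(u <- s) u 0 i = v 0 i.
  rewrite mxE.
  have [->|[v vJ ->] _] := H (enum_fset J) (head 0 (enum_fset J) 0 i).
    suff : v0 \in enum_fset J -> head 0 (enum_fset J) \in enum_fset J.
      by move=> h /h hJ; exists (head 0 (enum_fset J)).
    by case: (enum_fset J) => // x s _; rewrite mem_head.
  by exists v.
elim: s => [|w s IH]; first by left; rewrite big_nil.
rewrite big_cons; case: leP => _; last by right; exists w; rewrite ?mem_head.
by case: IH => [|[v vs]]; [left|right; exists v; rewrite // inE vs orbT].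
Qed.

Lemma vmax_eq J J' : J <> fset0 -> J' <> fset0 ->
  (forall u i, u \in J -> u 0 i <= vmax J' 0 i) ->
  (forall u i, u \in J' -> u 0 i <= vmax J 0 i) ->
  vmax J = vmax J'.
Proof.
move=> J0 J0' JJ' J'J; apply/rowP => i; apply/eqP; rewrite eq_le.
have [u uJ eu] := vmax_attained i J0; have [u' u'J eu'] := vmax_attained i J0'.
by rewrite {1}eu JJ' //= eu' J'J.
Qed.

(** Adding [h] to [J] would not change the coordinatewise maximum, which no set other than [J]
    attains. *)
Lemma scarf_closed J h : scarf_complex L J -> L h ->
  (forall i, h 0 i <= vmax J 0 i) -> h \in J.
Proof.
move=> [J0 JL Jmax] Lh hJ; apply: contrapT => nh.
have uJ x : x \in h |` J -> x = h \/ x \in J by case/fset1UP; [left|right].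
apply: (Jmax (h |` J)).
- by move=> e; have := fset1U1 h J; rewrite e inE.
- by move=> x /= /uJ[->//|/JL].
- by move=> e; apply: nh; rewrite -e fset1U1.
apply: vmax_eq => //.
- by move=> e; have := fset1U1 h J; rewrite e inE.
- by move=> u i uJ'; apply: vmax_ge; rewrite in_fset1U uJ' orbT.
- by move=> u i /uJ[->//|]; apply: vmax_ge.
Qed.

(** If [J''] has the maximum of [J'], exchanging [J'] for [J''] inside [J] preserves the maximum of
    [J], so the result is [J] and [J'] lies in [J'']. A point [y] of [J''] outside [J'] is below the
    maximum of [J'], so [J] and [J] without [y] have the same maximum, a contradiction. *)
Lemma scarf_subface J J' : scarf_complex L J -> J' <> fset0 -> J' `<=` J ->
  scarf_complex L J'.
Proof.
move=> [J0 JL Jmax] J'0 /fsubsetP J'J; split=> //.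
  by move=> x /= /J'J; apply: JL.
move=> J'' J''0 J''L neq emax.
have J''Jmax u i : u \in J'' -> u 0 i <= vmax J 0 i.
  move=> uJ''; apply: le_trans (vmax_ge i uJ'') _; rewrite -emax.
  by have [x xJ' ->] := vmax_attained i J'0; apply/vmax_ge/J'J.
have eM : J'' `|` (J `\` J') = J.
  apply: contrapT => neM; have M0 : J'' `|` (J `\` J') <> fset0.
    move/eqP: J''0 => /fset0Pn[x xJ''] e.
    by have : x \in fset0 by rewrite -e inE xJ''.
  apply: (Jmax _ M0 _ neM) => [x /=|].
    by rewrite !inE => /orP[/J''L|/andP[_ /JL]].
  apply: vmax_eq => // u i.
    move=> uJ; have [uJ'|uJ'] := boolP (u \in J'); last first.
      by apply: vmax_ge; rewrite !inE uJ' uJ orbT.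
    apply: le_trans (vmax_ge i uJ') _; rewrite emax.
    have [x xJ'' ->] := vmax_attained i J''0.
    by apply: vmax_ge; rewrite inE xJ''.
  by rewrite !inE => /orP[/J''Jmax//|/andP[_ uJ]]; apply: vmax_ge.
have J''J x : x \in J'' -> x \in J by move=> xJ''; rewrite -eM inE xJ''.
have J'J'' x : x \in J' -> x \in J''.
  by move=> xJ'; have := J'J _ xJ'; rewrite -{1}eM !inE xJ' /= orbF.
have [y yJ'' yJ'] : exists2 y, y \in J'' & y \notin J'.
  apply: contrapT => h; apply: neq; apply/fsetP => x.
  apply/idP/idP => [xJ''|/J'J''//]; apply: contrapT => /negP xJ'.
  by apply: h; exists x.
have D0 : J `\ y <> fset0.
  have [x xJ' e] := fset0Pn _ (introN eqP J'0).
  have : x \in fset0; last by [].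
  by rewrite -e !inE (J'J _ xJ') andbT; apply: contraNneq yJ' => <-.
apply: (Jmax _ D0) => [x /=||].
- by rewrite !inE => /andP[_ /JL].
- by move=> e; have := J''J _ yJ''; rewrite -e !inE eqxx.
apply: vmax_eq => // u i; last by rewrite !inE => /andP[_ uJ]; apply: vmax_ge.
move=> uJ; have [->|uy] := eqVneq u y; last by apply: vmax_ge; rewrite !inE uy.
apply: le_trans (vmax_ge i yJ'') _; rewrite -emax.
have [x xJ' ->] := vmax_attained i J'0; apply: vmax_ge.
by rewrite !inE (J'J _ xJ') andbT; apply: contraNneq yJ' => <-.
Qed.

Lemma in_translate u J v : (v \in translate u J) = (v - u \in J).
Proof.
apply/imfsetP/idP => [[w /= wJ ->]|vJ]; first by rewrite addrC addKr.
by exists (v - u) => //=; rewrite addrC subrK.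
Qed.

Lemma translate0 J : translate 0 J = J.
Proof. by apply/fsetP => v; rewrite in_translate subr0. Qed.

Lemma translateD u v J : translate u (translate v J) = translate (u + v) J.
Proof. by apply/fsetP => w; rewrite !in_translate opprD addrA. Qed.

Lemma translate_eq0 u J : translate u J = fset0 -> J = fset0.
Proof.
move=> e; apply/fsetP => v.
by rewrite inE -(addrK u v) -in_translate e inE.
Qed.

Lemma card_translate u J : #|` translate u J| = #|` J|.
Proof. by rewrite card_imfset //=; exact: addrI. Qed.

Lemma vmax_translate u J : J <> fset0 -> vmax (translate u J) = u + vmax J.
Proof.
move=> J0; have T0 : translate u J <> fset0 by move/translate_eq0.
apply/rowP => i; rewrite [RHS]mxE; apply/eqP; rewrite eq_le.
have [v vJ ev] := vmax_attained i J0; have [w wJ ew] := vmax_attained i T0.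
apply/andP; split.
  rewrite ew -lerBlDl; rewrite in_translate in wJ.
  by have := vmax_ge i wJ; rewrite [leLHS]mxE [X in _ + X]mxE.
have : u + v \in translate u J by rewrite in_translate addrC addKr.
by move=> /(vmax_ge i); rewrite [leLHS]mxE ev.
Qed.

Lemma scarf_translate u J :
  L u -> scarf_complex L J -> scarf_complex L (translate u J).
Proof.
move=> Lu [J0 JL Jmax]; split.
- by move/translate_eq0.
- move=> x /=; rewrite in_translate => /JL Lxu.
  by rewrite -(subrK u x); apply: LD.
move=> J' J'0 J'L neq; rewrite vmax_translate // => e.
have T0 : translate (- u) J' <> fset0 by move/translate_eq0.
apply: (Jmax _ T0).
- move=> x /=; rewrite in_translate opprK => /J'L Lxu.
  by rewrite -(addrK u x); apply: LB.
- by move=> e'; apply: neq; rewrite -e' translateD subrr translate0.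
- by rewrite vmax_translate // -e addKr.
Qed.

Lemma lattice_orbit_translate u J :
  L u -> lattice_orbit L (translate u J) = lattice_orbit L J.
Proof.
move=> Lu; apply/seteqP; split => _ [v Lv <-].
  by exists (v + u); rewrite ?translateD //; apply: LD.
by exists (v - u); [apply: LB|rewrite translateD subrK].
Qed.

End ScarfGeneral.

(** * The faces of the Scarf complex of L(m) *)

Section ScarfFaces.
Local Open Scope fset_scope.
Local Open Scope ring_scope.
Variables (m : nat) (m_gt0 : (0 < m)%N).

Definition edges : seq (seq nat) :=
  [:: [:: 0; 1]; [:: 0; 2]; [:: 1; 2]; [:: 1; 3]; [:: 2; 3]; [:: 1; 4];
      [:: 3; 4]; [:: 2; 5]; [:: 3; 5]; [:: 4; 5]; [:: 2; 6]; [:: 5; 6]]%N.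

(** For k from 1 to 3 these are the faces with k vertices besides 0; the entry at 0 is a dummy. *)
Definition faces (k : nat) : seq (seq nat) :=
  nth [::] [:: [::]; [seq [:: i] | i <- iota 0 7]; edges; tris] k.

Definition face_pts (A : seq nat) : {fset 'rV[int]_4} :=
  [fset v in [seq lat_pt m c | c <- face_coef A]].

Lemma L_sub u v : L m u -> L m v -> L m (u - v).
Proof.
move=> /L_lat_pt[[[p q] r] ->] /L_lat_pt[[[p' q'] r'] ->]; apply/L_lat_pt.
exists (p - p', q - q', r - r'); apply/rowP => -[[|[|[|[|//]]]] i4];
  rewrite !mxE /lval /=; ring.
Qed.

Lemma L_zero : L m 0.
Proof.
apply/L_lat_pt; exists (0, 0, 0); apply/rowP => -[[|[|[|[|//]]]] i4];
  by rewrite !mxE /lval.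
Qed.

Lemma lat_pt0 : lat_pt m (0, 0, 0) = 0.
Proof. by apply/rowP => -[[|[|[|[|//]]]] i4]; rewrite !mxE /lval. Qed.

Lemma in_face_pts A v :
  reflect (exists2 c, c \in face_coef A & v = lat_pt m c) (v \in face_pts A).
Proof. by rewrite in_fset; exact: mapP. Qed.

Lemma face_pts_neq0 A : face_pts A <> fset0.
Proof.
move=> e; have : 0 \in face_pts A.
  by apply/in_face_pts; exists (0, 0, 0); rewrite ?mem_head ?lat_pt0.
by rewrite e.
Qed.

Lemma face_pts_L A v : v \in face_pts A -> L m v.
Proof. by move=> /in_face_pts[c _ ->]; apply/L_lat_pt; exists c. Qed.

(** By [mem_face_coef], a set with the same maximum consists of vertices of [T]. It cannot omit a
    vertex, because each vertex is the strict maximum in some coordinate. *)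
Lemma scarf_tri T : T \in tris -> scarf_complex (L m) (face_pts T).
Proof.
move=> TP; split=> [||J' J'0 J'L neq emax].
- exact: face_pts_neq0.
- by move=> v /= /face_pts_L.
have J'T v : v \in J' -> v \in face_pts T.
  move=> vJ'; have /L_lat_pt[c ec] := J'L _ vJ'.
  apply/in_face_pts; exists c => //; apply: (mem_face_coef m_gt0 TP) => s.
  have [u /in_face_pts[c' c'T ->] eu] := vmax_attained s (@face_pts_neq0 T).
  by exists c' => //; rewrite -ec -eu emax; apply: vmax_ge.
have [x xT xJ'] : exists2 x, x \in face_pts T & x \notin J'.
  apply: contrapT => h; apply: neq; apply/fsetP => x.
  apply/idP/idP => [/J'T//|xT]; apply: contrapT => /negP xJ'.
  by apply: h; exists x.
have /in_face_pts[c cT ex] := xT.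
have /allP/(_ _ TP)/allP/(_ _ cT)/hasP[s] :
    all (fun T => all (fun c => has (fun s => all (fun c' => (c' == c) ||
      llt (sym_at c' s) (sym_at c s)) (face_coef T)) (iota 0 4))
    (face_coef T)) tris by vm_compute.
rewrite mem_iota => s4 /allP ltcs.
pose s' : 'I_4 := Ordinal s4.
have [u uJ' eu] := vmax_attained s' J'0.
have /in_face_pts[c' c'T eu'] := J'T _ uJ'.
have /orP[/eqP ec|/(lval_llt m_gt0) lt] := ltcs _ c'T.
  by rewrite ex -ec -eu' uJ' in xJ'.
have := vmax_ge s' xT; rewrite emax eu ex eu' !lat_ptE leNgt => /negP[].
exact: lt.
Qed.

Lemma face_pts_sub A B : {subset A <= B} -> face_pts A `<=` face_pts B.
Proof.
move=> AB; apply/fsubsetP => v /in_face_pts[c cA ->]; apply/in_face_pts.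
exists c => //; move: cA; rewrite !inE => /orP[->//|/mapP[i /AB iB ->]].
by rewrite map_f ?orbT.
Qed.

Lemma scarf_face k A : A \in faces k -> scarf_complex (L m) (face_pts A).
Proof.
move=> Ak; have /hasP[T TP /allP AT] : has (fun T => all (mem T) A) tris.
  have [k4|k4] := ltnP k 4; last by rewrite /faces nth_default in Ak.
  have : all (fun k => all (fun A => has (fun T => all (mem T) A) tris)
      (faces k)) (iota 0 4) by vm_compute.
  move=> /allP/(_ k); rewrite mem_iota => /(_ k4)/allP; exact.
exact: scarf_subface (scarf_tri TP) (@face_pts_neq0 A) (face_pts_sub AT).
Qed.

Lemma lat_pt_inj :
  {in (0, 0, 0) :: nbr_coef &, injective (lat_pt m)}.
Proof.
move=> c c' cP c'P e; apply/eqP.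
have : all (fun c => all (fun c' => (c == c') || has (fun s =>
      llt (sym_at c s) (sym_at c' s) || llt (sym_at c' s) (sym_at c s))
    (iota 0 4)) ((0, 0, 0) :: nbr_coef)) ((0, 0, 0) :: nbr_coef).
  by vm_compute.
move=> /allP/(_ _ cP)/allP/(_ _ c'P)/orP[//|/hasP[s]].
rewrite mem_iota => s4 h.
have es : lval m (sym_at c s) = lval m (sym_at c' s).
  by have := congr1 (fun v : 'rV_4 => v 0 (Ordinal s4)) e; rewrite !lat_ptE.
by case/orP: h => /(lval_llt m_gt0); rewrite es ltxx.
Qed.

Lemma nbr_mem i : (i < 7)%N -> nbr i \in nbr_coef.
Proof. by move=> i7; rewrite mem_nth. Qed.

Lemma nbr_mem0 i : (i < 7)%N -> nbr i \in (0, 0, 0) :: nbr_coef.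
Proof. by move=> i7; rewrite in_cons nbr_mem ?orbT. Qed.

Lemma nbr_pt_inj i j : (i < 7)%N -> (j < 7)%N ->
  lat_pt m (nbr i) = lat_pt m (nbr j) -> i = j.
Proof.
move=> i7 j7 /(lat_pt_inj (nbr_mem0 i7) (nbr_mem0 j7))/eqP.
by rewrite nth_uniq // => /eqP.
Qed.

Lemma nbr_top i : (i < 7)%N -> lat_pt m (nbr i) 0 (inord 3) < 0.
Proof.
move=> i7; have : all (fun i => llt (sym_at (nbr i) 3) (0, 0)) (iota 0 7).
  by vm_compute.
move=> /allP/(_ i); rewrite mem_iota => /(_ i7)/(lval_llt m_gt0).
by rewrite lat_ptE inordK.
Qed.

Lemma nbr_neq0 i : (i < 7)%N -> lat_pt m (nbr i) != 0.
Proof. by move=> /nbr_top; apply: contraTneq => ->; rewrite mxE ltxx. Qed.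

Lemma nbr_in_face A i : all (fun i => i < 7)%N A -> (i < 7)%N ->
  (lat_pt m (nbr i) \in face_pts A) = (i \in A).
Proof.
move=> /allP A7 i7; apply/in_face_pts/idP => [[c]|iA]; last first.
  by exists (nbr i); rewrite // inE (map_f nbr iA) orbT.
rewrite inE => /orP[/eqP-> e|/mapP[j jA ->] /nbr_pt_inj-> //].
  by have := nbr_neq0 i7; rewrite e lat_pt0 eqxx.
exact: A7.
Qed.

Lemma faces_lt7 k A : A \in faces k -> all (fun i => i < 7)%N A.
Proof.
have [k4|k4] := ltnP k 4; last by rewrite /faces nth_default.
have : all (fun k => all (fun A => all (fun i => i < 7)%N A) (faces k))
  (iota 0 4) by vm_compute.
move=> /allP/(_ k); rewrite mem_iota => /(_ k4)/allP; exact.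
Qed.

Lemma card_face_pts A : uniq A -> all (fun i => i < 7)%N A ->
  #|` face_pts A| = (size A).+1.
Proof.
move=> Au /allP A7.
suff pts_uniq : uniq [seq lat_pt m c | c <- face_coef A].
  by rewrite card_fseq undup_id // size_map /= size_map.
rewrite map_inj_in_uniq; last first.
  have sub c : c \in face_coef A -> c \in (0, 0, 0) :: nbr_coef.
    rewrite !in_cons => /orP[->//|/mapP[i /A7 i7 ->]].
    by have := nbr_mem0 i7; rewrite in_cons.
  by move=> c c' /sub cP /sub c'P; apply: lat_pt_inj.
rewrite /= map_inj_in_uniq ?Au ?andbT.
  apply/mapP => -[i /A7 i7] /esym e.
  by have := nbr_neq0 i7; rewrite /nbr e lat_pt0 eqxx.
by move=> i j /A7 i7 /A7 j7 e; apply: nbr_pt_inj => //; rewrite /nbr e.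
Qed.

(* A set of neighbors that is not listed is not a face, as some neighbor lies
   below the coordinatewise maximum of the other ones. *)
Lemma mask_face (b : seq bool) k : size b = 7 -> (k < 3)%N ->
  size (mask b (iota 0 7)) = k.+1 -> mask b (iota 0 7) \notin faces k.+1 ->
  has (fun l =>
    all (fun s => has (fun c => lle (sym_at (nbr l) s) (sym_at c s))
      (face_coef (filter (predC1 l) (mask b (iota 0 7))))) (iota 0 4))
    (iota 0 7).
Proof.
case: b => // b0 [|b1 [|b2 [|b3 [|b4 [|b5 [|b6 []]]]]]] // _.
case: k => [|[|[|//]]] _.
- by case: b0; case: b1; case: b2; case: b3; case: b4; case: b5; case: b6;
    vm_compute.
- by case: b0; case: b1; case: b2; case: b3; case: b4; case: b5; case: b6;
    vm_compute.
- by case: b0; case: b1; case: b2; case: b3; case: b4; case: b5; case: b6;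
    vm_compute.
Qed.

(** For a nonzero v in [J], a neighbor h <= max(0, v) belongs to the face {0, v} by [scarf_closed],
    so v = h. Thus [J] consists of 0 and neighbors, and [mask_face] together with [scarf_closed]
    rules out the unlisted sets of neighbors. *)
Lemma scarf_top_face k J : (k < 3)%N -> scarf_complex (L m) J ->
  #|` J| = k.+2 -> 0 \in J -> (forall v, v \in J -> v 0 (inord 3) <= 0) ->
  exists2 A, A \in faces k.+1 & J = face_pts A.
Proof.
move=> k3 Jscarf Jk J0 Jtop; have [_ JL _] := Jscarf.
have Jnbr v : v \in J -> v != 0 -> exists2 i, (i < 7)%N & v = lat_pt m (nbr i).
  move=> vJ v0; have /L_lat_pt[c ec] := JL _ vJ.
  rewrite ec in v0; have [|i i7 le_i] := exists_nbr_le m_gt0 v0.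
    by rewrite -ec Jtop.
  exists i => //.
  have Li : L m (lat_pt m (nbr i)) by apply/L_lat_pt; exists (nbr i).
  pose J' := [fset 0; v].
  have J'_scarf : scarf_complex (L m) J'.
    apply: scarf_subface Jscarf _ _.
      by move=> e; have := fset21 0 v; rewrite -/J' e.
    by apply/fsubsetP => x /fset2P[->|->].
  have : lat_pt m (nbr i) \in J'.
    apply: scarf_closed J'_scarf Li _ => s; apply: le_trans (le_i s) _.
    rewrite ge_max -ec (vmax_ge s (fset22 0 v)) andbT.
    by have := vmax_ge s (fset21 0 v); rewrite mxE.
  by case/fset2P => // e; have := nbr_neq0 i7; rewrite e eqxx.
(* A mask presents the set of neighbors in [J] as one of the 128 subsets that [mask_face] runs
   through. *)
pose b := [seq lat_pt m (nbr i) \in J | i <- iota 0 7].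
pose A := mask b (iota 0 7).
have A7 : all (fun i => i < 7)%N A.
  by apply/allP => i /mem_mask; rewrite mem_iota.
have eA : A = [seq i <- iota 0 7 | lat_pt m (nbr i) \in J].
  by rewrite /A /b filter_mask.
have eJ : J = face_pts A.
  apply/fsetP => v; apply/idP/in_face_pts => [vJ|[c]].
    have [->|v0] := eqVneq v 0.
      by exists (0, 0, 0); rewrite ?mem_head ?lat_pt0.
    have [i i7 ev] := Jnbr v vJ v0; exists (nbr i) => //.
    rewrite inE; apply/orP; right; apply/map_f.
    by rewrite eA mem_filter -ev vJ mem_iota.
  rewrite inE => /orP[/eqP-> ->|/mapP[i iA ->] ->]; first by rewrite lat_pt0.
  by move: iA; rewrite eA mem_filter => /andP[].
have sA : size A = k.+1.
  apply/eq_add_S; rewrite -card_face_pts ?mask_uniq ?iota_uniq //.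
  by rewrite -eJ Jk.
exists A => //; apply: contraT => nA.
have b7 : size b = 7 by rewrite size_map size_iota.
have /hasP[l] := mask_face b7 k3 sA nA.
rewrite -/A mem_iota => l7 /allP le_l.
have A'7 : all (fun i => i < 7)%N (filter (predC1 l) A).
  by apply/allP => i; rewrite mem_filter => /andP[_ /(allP A7)].
have A'_scarf : scarf_complex (L m) (face_pts (filter (predC1 l) A)).
  apply: scarf_subface Jscarf (@face_pts_neq0 _) _; rewrite eJ.
  by apply: face_pts_sub => i; rewrite mem_filter => /andP[].
have Ll : L m (lat_pt m (nbr l)) by apply/L_lat_pt; exists (nbr l).
have : lat_pt m (nbr l) \in face_pts (filter (predC1 l) A).
  apply: scarf_closed A'_scarf Ll _ => s.
  have s_in : nat_of_ord s \in iota 0 4 by rewrite mem_iota ltn_ord.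
  have /hasP[c cA /(lval_lle m_gt0) le_c] := le_l s s_in.
  rewrite lat_ptE (le_trans le_c) // -lat_ptE; apply: vmax_ge.
  by apply/in_face_pts; exists c.
by rewrite nbr_in_face // mem_filter /= eqxx.
Qed.

(** The equality case says that 0 is the only topmost vertex, which singles out one representative
    in each orbit of faces. *)
Lemma face_pts_top A v : all (fun i => i < 7)%N A -> v \in face_pts A ->
  v 0 (inord 3) <= 0 ?= iff (v == 0).
Proof.
move=> /allP A7 /in_face_pts[c]; rewrite inE => /orP[/eqP-> ->|].
  by rewrite lat_pt0 eqxx mxE; split.
move=> /mapP[i /A7 i7 ->] ->.
by split; [apply/ltW/nbr_top|rewrite lt_eqF ?nbr_top // (negPf (nbr_neq0 i7))].
Qed.

(** Moving a topmost vertex to 0 brings every face into the list, and no two listed faces are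
    translates of each other. A face with k + 2 vertices has k + 1 vertices besides 0. *)
Lemma scarf_f_faces k : (k < 3)%N -> scarf_f_eq (L m) k (size (faces k.+1)).
Proof.
move=> k3; pose orb A := lattice_orbit (L m) (face_pts A).
have facesP i : (i < size (faces k.+1))%N -> let A := nth [::] (faces k.+1) i in
    [/\ A \in faces k.+1, uniq A, size A = k.+1 & all (fun i => i < 7)%N A].
  move=> iN A; have Ak : A \in faces k.+1 by rewrite mem_nth.
  have /allP/(_ k) : all (fun k => all (fun A => uniq A && (size A == k.+1))
      (faces k.+1)) (iota 0 3) by vm_compute.
  rewrite mem_iota => /(_ k3)/allP/(_ _ Ak)/andP[Au /eqP sA].
  by split=> //; exact: faces_lt7 Ak.
rewrite /scarf_f_eq; have -> : scarf_orbits (L m) k.+2 =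
    ((fun i => orb (nth [::] (faces k.+1) i))
      @` `I_(size (faces k.+1)))%classic.
  apply/seteqP; split => [_ [J [Jscarf Jk] <-]|_ [i iN <-]] /=.
    have [J0 JL _] := Jscarf.
    have [t tJ et] := vmax_attained (inord 3) J0.
    have Lt : L m (- t).
      by rewrite -sub0r; apply: L_sub; [exact: L_zero|exact: JL].
    have [||||A Ak eJ1] := @scarf_top_face k (translate (- t) J) k3.
    - exact (scarf_translate L_zero L_sub Lt Jscarf).
    - by rewrite card_translate.
    - by rewrite in_translate sub0r opprK.
    - move=> v; rewrite in_translate opprK => /(vmax_ge (inord 3)).
      by rewrite et mxE gerDr.
    exists (index A (faces k.+1)); rewrite /= ?index_mem // nth_index //.
    rewrite /orb -eJ1 lattice_orbit_translate //; first exact: L_zero.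
    exact: L_sub.
  have [Ak Au sA A7] := facesP i iN.
  exists (face_pts (nth [::] (faces k.+1) i)) => //; split.
    exact: scarf_face Ak.
  by rewrite card_face_pts // sA.
apply: inj_card_eq => i j /set_mem iN /set_mem jN e.
have [Ai iu si Ai7] := facesP i iN; have [Aj ju sj Aj7] := facesP j jN.
move: e Ai iu si Ai7 Aj ju sj Aj7.
set A := nth _ _ i; set A' := nth _ _ j => e Ai iu si Ai7 Aj ju sj Aj7.
have zero_in B : 0 \in face_pts B.
  by apply/in_face_pts; exists (0, 0, 0); rewrite ?mem_head ?lat_pt0.
(* If translation by [u] takes one face to the other, then [u] lies in the second and [- u] in the
   first; both have last coordinate at most 0, so [u] is the unique topmost vertex 0. *)
have eF : face_pts A = face_pts A'.
  have [u Lu eu] : orb A (face_pts A').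
    by rewrite e; exists 0; [exact: L_zero|rewrite translate0].
  suff u0 : u = 0 by rewrite -eu u0 translate0.
  have uA' : u \in face_pts A' by rewrite -eu in_translate subrr.
  have uA : - u \in face_pts A by rewrite -[- u]sub0r -in_translate eu.
  apply/eqP; rewrite -(face_pts_top Aj7 uA') eq_le (face_pts_top Aj7 uA') /=.
  by have [le_u _] := face_pts_top Ai7 uA; rewrite mxE oppr_le0 in le_u.
(* Different lists of indices could still have the same elements; the tables exclude this. *)
have /allP/(_ k) : all (fun k => uniq (faces k.+1) &&
    all (fun A : seq nat => all (fun A' : seq nat =>
      (A == A') || ~~ all (mem A') A) (faces k.+1)) (faces k.+1)) (iota 0 3).
  by vm_compute.
rewrite mem_iota => /(_ k3)/andP[Fu].
move=> /allP/(_ A Ai)/allP/(_ A' Aj)/orP[/eqP eA|].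
  by apply/eqP; rewrite -(nth_uniq [::] iN jN Fu); apply/eqP.
case/negP; apply/allP => x xA /=; have x7 := allP Ai7 _ xA.
by rewrite -(nbr_in_face Aj7 x7) -eF nbr_in_face.
Qed.

End ScarfFaces.

(* ((s, k), [:: (c_0, d_0); ..; (c_3, d_3)]) stands for
   (-1)^s x_0^(c_0 + d_0 m) .. x_3^(c_3 + d_3 m) e_k. *)
Definition sym_mnm : Type := seq (nat * nat).
Definition sym_term : Type := (bool * nat * sym_mnm)%type.

(* Boundary maps of the Scarf complex, with one row for each face, in the order
   of [faces]; a facet without 0 is first translated so that its vertex with
   the largest last coordinate becomes 0. Leading terms come first. *)
Definition res_rows0 : seq (seq sym_term) :=
  [::
   [:: (false, 0, [:: (0, 0); (0, 0); (4, 2); (0, 0)]);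
       (true, 0, [:: (1, 0); (2, 1); (0, 0); (1, 1)])];
   [:: (false, 0, [:: (0, 0); (1, 0); (3, 1); (0, 0)]);
       (true, 0, [:: (2, 0); (0, 0); (0, 0); (2, 1)])];
   [:: (false, 0, [:: (2, 1); (0, 0); (2, 1); (0, 0)]);
       (true, 0, [:: (0, 0); (0, 1); (0, 0); (3, 1)])];
   [:: (false, 0, [:: (1, 1); (3, 0); (1, 0); (0, 0)]);
       (true, 0, [:: (0, 0); (0, 0); (0, 0); (4, 1)])];
   [:: (false, 0, [:: (0, 0); (3, 1); (0, 0); (0, 0)]);
       (true, 0, [:: (1, 0); (0, 0); (1, 1); (1, 0)])];
   [:: (false, 0, [:: (3, 1); (2, 0); (0, 0); (0, 0)]);
       (true, 0, [:: (0, 0); (0, 0); (2, 1); (2, 0)])];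
   [:: (false, 0, [:: (4, 1); (0, 0); (0, 0); (0, 0)]);
       (true, 0, [:: (0, 0); (1, 1); (1, 0); (1, 0)])]]%N.

Definition res_rows1 : seq (seq sym_term) :=
  [::
   [:: (true, 1, [:: (0, 0); (0, 0); (1, 1); (0, 0)]);
       (false, 0, [:: (0, 0); (1, 0); (0, 0); (0, 0)]);
       (false, 4, [:: (1, 0); (0, 0); (0, 0); (1, 1)])];
   [:: (true, 2, [:: (0, 0); (0, 0); (2, 1); (0, 0)]);
       (false, 0, [:: (2, 1); (0, 0); (0, 0); (0, 0)]);
       (false, 5, [:: (0, 0); (0, 1); (0, 0); (1, 1)])];
   [:: (true, 2, [:: (0, 0); (1, 0); (1, 0); (0, 0)]);
       (false, 1, [:: (2, 1); (0, 0); (0, 0); (0, 0)]);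
       (false, 6, [:: (0, 0); (0, 0); (0, 0); (2, 1)])];
   [:: (true, 3, [:: (0, 0); (0, 0); (2, 1); (0, 0)]);
       (false, 1, [:: (1, 1); (2, 0); (0, 0); (0, 0)]);
       (false, 5, [:: (0, 0); (0, 0); (0, 0); (2, 1)])];
   [:: (true, 3, [:: (1, 0); (0, 0); (1, 1); (0, 0)]);
       (false, 2, [:: (0, 0); (3, 0); (0, 0); (0, 0)]);
       (false, 4, [:: (0, 0); (0, 0); (0, 0); (3, 1)])];
   [:: (true, 4, [:: (0, 0); (0, 0); (3, 1); (0, 0)]);
       (false, 1, [:: (0, 0); (2, 1); (0, 0); (0, 0)]);
       (true, 0, [:: (1, 0); (0, 0); (0, 0); (1, 0)])];
   [:: (true, 4, [:: (1, 1); (0, 0); (1, 0); (0, 0)]);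
       (false, 3, [:: (0, 0); (0, 1); (0, 0); (0, 0)]);
       (true, 2, [:: (0, 0); (0, 0); (0, 0); (1, 0)])];
   [:: (true, 5, [:: (0, 0); (0, 0); (2, 1); (0, 0)]);
       (false, 2, [:: (1, 0); (2, 0); (0, 0); (0, 0)]);
       (true, 0, [:: (0, 0); (0, 0); (0, 0); (2, 0)])];
   [:: (true, 5, [:: (0, 0); (1, 0); (1, 0); (0, 0)]);
       (false, 3, [:: (2, 0); (0, 0); (0, 0); (0, 0)]);
       (true, 1, [:: (0, 0); (0, 0); (0, 0); (2, 0)])];
   [:: (true, 5, [:: (0, 0); (1, 1); (0, 0); (0, 0)]);
       (false, 4, [:: (3, 1); (0, 0); (0, 0); (0, 0)]);
       (false, 6, [:: (0, 0); (0, 0); (1, 1); (1, 0)])];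
   [:: (true, 6, [:: (0, 0); (0, 0); (2, 1); (0, 0)]);
       (false, 2, [:: (2, 0); (0, 0); (0, 0); (0, 0)]);
       (true, 1, [:: (0, 0); (0, 1); (0, 0); (1, 0)])];
   [:: (true, 6, [:: (0, 0); (2, 0); (0, 0); (0, 0)]);
       (false, 5, [:: (1, 0); (0, 0); (0, 0); (0, 0)]);
       (true, 4, [:: (0, 0); (0, 0); (1, 0); (1, 0)])]]%N.

Definition res_rows2 : seq (seq sym_term) :=
  [::
   [:: (true, 2, [:: (0, 0); (0, 0); (1, 1); (0, 0)]);
       (false, 1, [:: (0, 0); (1, 0); (0, 0); (0, 0)]);
       (true, 0, [:: (2, 1); (0, 0); (0, 0); (0, 0)]);
       (false, 9, [:: (0, 0); (0, 0); (0, 0); (1, 1)])];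
   [:: (true, 4, [:: (0, 0); (0, 0); (1, 0); (0, 0)]);
       (false, 3, [:: (1, 0); (0, 0); (0, 0); (0, 0)]);
       (true, 2, [:: (0, 0); (2, 0); (0, 0); (0, 0)]);
       (true, 11, [:: (0, 0); (0, 0); (0, 0); (2, 1)])];
   [:: (true, 6, [:: (0, 0); (0, 0); (2, 1); (0, 0)]);
       (false, 5, [:: (1, 1); (0, 0); (0, 0); (0, 0)]);
       (true, 3, [:: (0, 0); (0, 1); (0, 0); (0, 0)]);
       (false, 1, [:: (0, 0); (0, 0); (0, 0); (1, 0)])];
   [:: (true, 8, [:: (0, 0); (0, 0); (1, 1); (0, 0)]);
       (false, 7, [:: (0, 0); (1, 0); (0, 0); (0, 0)]);
       (true, 4, [:: (1, 0); (0, 0); (0, 0); (0, 0)]);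
       (false, 0, [:: (0, 0); (0, 0); (0, 0); (2, 0)])];
   [:: (true, 9, [:: (0, 0); (0, 0); (1, 0); (0, 0)]);
       (false, 8, [:: (0, 0); (0, 1); (0, 0); (0, 0)]);
       (true, 6, [:: (2, 0); (0, 0); (0, 0); (0, 0)]);
       (true, 10, [:: (0, 0); (0, 0); (0, 0); (1, 0)])];
   [:: (true, 11, [:: (0, 0); (0, 0); (2, 1); (0, 0)]);
       (false, 10, [:: (0, 0); (2, 0); (0, 0); (0, 0)]);
       (true, 7, [:: (1, 0); (0, 0); (0, 0); (0, 0)]);
       (false, 5, [:: (0, 0); (0, 0); (0, 0); (1, 0)])]]%N.

(** * Conditions on the tables, checked by computation, and their meaning for a fixed m *)

Section Tables.

Definition res_rows (i : nat) : seq (seq sym_term) :=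
  nth [::] [:: res_rows0; res_rows1; res_rows2] i.

Definition res_rank (i : nat) : nat := nth 0 [:: 1; 7; 12; 6] i.

Definition sym_exp (s : sym_mnm) (i : nat) : nat * nat := nth (0, 0) s i.

Definition sym_add (s t : sym_mnm) : sym_mnm :=
  [seq ((sym_exp s i).1 + (sym_exp t i).1, (sym_exp s i).2 + (sym_exp t i).2)
     | i <- iota 0 4].

Definition sym_lead (l : seq sym_term) : sym_term := head (false, 0, [::]) l.

(* A face is labeled by the coordinatewise maximum of its vertices. *)
Fixpoint res_labels (i : nat) : seq sym_mnm :=
  if i is i'.+1 then
    [seq sym_add (sym_lead l).2 (nth [::] (res_labels i') (sym_lead l).1.2)
       | l <- res_rows i']
  else [:: [::]].

(** Sufficient for [well_led] for all m >= 1: the leading term is free of x_4, and any other term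
    either contains x_4 or has a smaller index. *)
Definition sym_well_led (r : nat) (l : seq sym_term) : bool :=
  [&& l != [::], all (fun t => t.1.2 < r) l,
      sym_exp (sym_lead l).2 3 == (0, 0)
    & all (fun t => (sym_exp t.2 3 != (0, 0)) || (t.1.2 < (sym_lead l).1.2))
        (behead l)].

(** The condition on [x], [y], [y'] ensures x <= y' - y with truncated subtraction for all m >= 1,
    by comparing the slopes and the values at m = 1 of x + y and y'. *)
Definition sym_covers (P Q : seq (seq sym_term)) : bool :=
  all (fun j => all (fun j' =>
    let t := sym_lead (nth [::] P j) in let t' := sym_lead (nth [::] P j') in
    (t.1.2 == t'.1.2) ==>
    has (fun l => ((sym_lead l).1.2 == j) && all (fun s =>
        let x := sym_exp (sym_lead l).2 s in
        let y := sym_exp t.2 s in let y' := sym_exp t'.2 s in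
        (x == (0, 0)) || ((x.2 + y.2 <= y'.2) &&
          (x.1 + x.2 + (y.1 + y.2) <= y'.1 + y'.2))) (iota 0 4)) Q)
    (iota 0 j)) (iota 0 (size P)).

Definition sym_compose (P : seq (seq sym_term)) (l : seq sym_term) :
    seq sym_term :=
  flatten [seq [seq (t.1.1 (+) t'.1.1, t'.1.2, sym_add t.2 t'.2)
                  | t' <- nth [::] P t.1.2] | t <- l].

Definition sym_cancels (l : seq sym_term) : bool :=
  perm_eq [seq (t.1.2, t.2) | t <- l & t.1.1]
          [seq (t.1.2, t.2) | t <- l & ~~ t.1.1].

(* Coefficients of the weighted degree, as a polynomial in m. *)
Definition sym_wdeg (s : sym_mnm) : seq nat :=
  let c i := (sym_exp s i).1 in let d i := (sym_exp s i).2 in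
  [:: 20 * c 0 + 25 * c 1 + 25 * c 2 + 30 * c 3;
      21 * c 0 + 25 * c 1 + 26 * c 2 + 28 * c 3
        + (20 * d 0 + 25 * d 1 + 25 * d 2 + 30 * d 3);
      7 * c 0 + 8 * c 1 + 8 * c 2 + 8 * c 3
        + (21 * d 0 + 25 * d 1 + 26 * d 2 + 28 * d 3);
      c 0 + c 1 + c 2 + c 3 + (7 * d 0 + 8 * d 1 + 8 * d 2 + 8 * d 3);
      d 0 + d 1 + d 2 + d 3].

(** Degrees are compared through their coefficients in m, which settles all m at once. *)
Definition sym_homogeneous (i : nat) : bool :=
  all (fun j => all (fun t =>
    sym_wdeg (sym_add t.2 (nth [::] (res_labels i) t.1.2))
      == sym_wdeg (nth [::] (res_labels i.+1) j)) (nth [::] (res_rows i) j))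
    (iota 0 (size (res_rows i))).

(** For i = 2 the covering condition holds against an empty table because the six rows have leading
    terms in distinct components; this yields the injectivity of the last map. *)
Lemma res_rows_check i :
  [&& size (res_rows i) == res_rank i.+1,
      all (sym_well_led (res_rank i)) (res_rows i),
      sym_covers (res_rows i) (res_rows i.+1),
      all (fun l => sym_cancels (sym_compose (res_rows i) l)) (res_rows i.+1)
    & sym_homogeneous i &&
      all (all (fun t => has (fun s => sym_exp t.2 s != (0, 0)) (iota 0 4)))
        (res_rows i)].
Proof.
case: i => [|[|[|i]]]; [by vm_compute|by vm_compute|by vm_compute|].
have nil k : res_rows k.+3 = [::] by rewrite /res_rows /= nth_nil.
by rewrite /sym_homogeneous !nil /res_rank /= nth_nil.
Qed.

Section Fixed_m.
Variables (m : nat) (m_gt0 : 0 < m).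

Definition exp_val (x : nat * nat) : nat := x.1 + x.2 * m.

Definition mnm_val (s : sym_mnm) : 'X_{1..4} :=
  [multinom exp_val (sym_exp s i) | i < 4].

Definition term_val (t : sym_term) : term 4 := (t.1, mnm_val t.2).

Definition rows (i : nat) : seq (seq (term 4)) :=
  [seq [seq term_val t | t <- l] | l <- res_rows i].

Definition res_deg (i j : nat) : nat :=
  wdeg (weights m) (mnm_val (nth [::] (res_labels i) j)).

Lemma mnm_valD s t : mnm_val (sym_add s t) = (mnm_val s + mnm_val t)%MM.
Proof.
apply/mnmP => i; rewrite mnmDE !mnmE /sym_add {1}/sym_exp.
rewrite (nth_map 0) ?size_iota ?ltn_ord // nth_iota ?ltn_ord //.
by rewrite /exp_val /=; ring.
Qed.

Lemma lead_val l : lead [seq term_val t | t <- l] = term_val (sym_lead l).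
Proof.
case: l => //=; rewrite /lead /term_val /=; congr (_, _).
by apply/mnmP => i; rewrite !mnmE /sym_exp nth_nil.
Qed.

Lemma lead_rows i j :
  lead (nth [::] (rows i) j) = term_val (sym_lead (nth [::] (res_rows i) j)).
Proof.
rewrite -lead_val /rows; have [jP|jP] := ltnP j (size (res_rows i)).
  by rewrite (nth_map [::]).
by rewrite !nth_default ?size_map.
Qed.

Lemma exp_val_gt0 x : x != (0, 0) -> 0 < exp_val x.
Proof. by case: x => [[|a] [|b]] // _; rewrite /exp_val /=; nia. Qed.

Lemma well_led_val r l : sym_well_led r l ->
  well_led (inord 3) r [seq term_val t | t <- l].
Proof.
case/and4P => l0 /allP lr /eqP e3 /allP ltl; apply/and3P; split.
- by case: (l) l0.
- by rewrite all_map; apply/allP => t /lr.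
rewrite lead_val behead_map all_map; apply/allP => t tl /=.
have tr : t.1.2 < r by apply: lr; exact: mem_behead tl.
rewrite /corank !mnmE inordK // e3.
have -> : exp_val (0, 0) = 0 by [].
rewrite mul0n add0n.
set e := exp_val _.
case/orP: (ltl _ tl) => [/exp_val_gt0 e0|lt]; last first.
  by rewrite ltn_addl ?ltn_sub2l // (ltn_trans lt).
(* The leading term has [corank] at most [r]. A positive exponent of x_4 contributes at least [r],
   and the index part is positive by [tr]. *)
apply: leq_ltn_trans (leq_subr _ _) _.
by rewrite -{1}[r]addn0 -addnS leq_add ?leq_pmull ?subn_gt0.
Qed.

Lemma covers_val P Q : sym_covers P Q ->
  schreyer_covers [seq [seq term_val t | t <- l] | l <- P]
    [seq [seq term_val t | t <- l] | l <- Q].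
Proof.
move=> /allP cPQ j' j; rewrite size_map => /andP[j'j jP].
rewrite !(nth_map [::]) // ?(ltn_trans j'j) // !lead_val => ejj.
have /allP/(_ j') := cPQ j (ltac:(by rewrite mem_iota)).
rewrite mem_iota => /(_ j'j)/implyP/(_ (introT eqP (esym ejj))).
move=> /hasP[l lQ /andP[lj /allP le_l]].
apply/hasP; exists [seq term_val t | t <- l]; first exact: map_f.
rewrite lead_val lj /=; apply/mnm_lepP => s; rewrite mnmBE !mnmE.
have /orP[/eqP->//|/andP[]] := le_l s (ltac:(by rewrite mem_iota ltn_ord)).
by rewrite /exp_val; nia.
Qed.

Lemma sym_wdegE s : wdeg (weights m) (mnm_val s) =
  let a := sym_wdeg s in
  nth 0 a 0 + nth 0 a 1 * m + nth 0 a 2 * m ^ 2 + nth 0 a 3 * m ^ 3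
    + nth 0 a 4 * m ^ 4.
Proof.
rewrite /wdeg !big_ord_recr big_ord0 /= !mnmE /weights /= /exp_val /sym_exp.
ring.
Qed.

End Fixed_m.
End Tables.

(** * The minimal free resolution *)

Section Resolution.
Local Open Scope ring_scope.
Variables (K : fieldType) (m : nat) (m_gt0 : (0 < m)%N).
Local Notation S := {mpoly K[4]}.
Local Notation w := (weights m).
Local Notation rows := (rows m).
Local Notation res_deg := (res_deg m).

Definition res_diff (i : nat) : 'M[S]_(res_rank i.+1, res_rank i) :=
  rows_mx K (res_rank i.+1) (res_rank i) (rows i).

Definition resolution : graded_free_seq K 4 :=
  @GradedFreeSeq K 4 res_rank (fun i j => (res_deg i j)%:Z) (const_mx 1)
    res_diff.

Lemma size_rows i : size (rows i) = res_rank i.+1.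
Proof. by rewrite size_map; have /and5P[/eqP] := res_rows_check i. Qed.

Lemma well_led_rows i : all (well_led (inord 3) (res_rank i)) (rows i).
Proof.
have /and5P[_ /allP led _ _ _] := res_rows_check i.
by rewrite all_map; apply/allP => l /led /(well_led_val m_gt0).
Qed.

Lemma deg_rows i j t : (j < size (rows i))%N -> t \in nth [::] (rows i) j ->
  (wdeg w t.2 + res_deg i t.1.2 = res_deg i.+1 j)%N.
Proof.
rewrite size_map => ji; rewrite (nth_map [::]) // => /mapP[s sl ->].
have /and5P[_ _ _ _ /andP[/allP hom _]] := res_rows_check i.
have /allP/(_ _ sl)/eqP e := hom j (ltac:(by rewrite mem_iota)).
by rewrite /res_deg -wdegD -mnm_valD !sym_wdegE e.
Qed.

Lemma homogeneous_rows i l : l \in rows i -> homogeneous_row w (res_deg i) l.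
Proof.
move=> li t tl; have /allP/(_ _ li)/and3P[l0 _ _] := well_led_rows i.
have lead_in : lead l \in l by case: (l) l0 => // x s _; rewrite mem_head.
have ji : (index l (rows i) < size (rows i))%N by rewrite index_mem.
have degE x : x \in l -> _ := fun xl => @deg_rows i (index l (rows i)) x ji
  (eq_ind_r (fun l' => x \in l') xl (nth_index [::] li)).
by rewrite !degE.
Qed.

(** The composite is expanded with symbolic exponents, and its terms cancel in pairs before m is
    given a value. *)
Lemma diff_diff_rows i : res_diff i.+1 *m res_diff i = 0.
Proof.
apply/row_matrixP => j; rewrite row_mul row0 rowK.
have ji : (j < size (rows i.+1))%N by rewrite size_rows.
have jP : nth [::] (rows i.+1) j \in rows i.+1 by rewrite mem_nth.
have /allP/(_ _ jP)/and3P[_ lr _] := well_led_rows i.+1.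
rewrite row_vec_mul //; apply: row_vec_cancel.
rewrite size_map in ji; rewrite (nth_map [::]) //.
have /and5P[_ _ _ /allP canc _] := res_rows_check i.
have := canc _ (mem_nth [::] ji); set l := nth _ _ _ => {}canc.
have -> : flatten [seq [seq (t.1.1 (+) t'.1.1, t'.1.2, (t.2 + t'.2)%MM)
      | t' <- nth [::] (rows i) t.1.2] | t <- [seq term_val m t | t <- l]]
    = [seq term_val m t | t <- sym_compose (res_rows i) l].
  rewrite /sym_compose map_flatten -!map_comp; congr flatten.
  apply: eq_map => t /=; have [ti|ti] := ltnP t.1.2 (size (res_rows i)).
    rewrite (nth_map [::]) // -!map_comp; apply: eq_map => t' /=.
    by rewrite /term_val mnm_valD.
  by rewrite !nth_default ?size_map.
have E (p : pred bool) : [seq (t.1.2, t.2)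
      | t <- [seq term_val m t | t <- sym_compose (res_rows i) l] & p t.1.1]
    = [seq (x.1, mnm_val m x.2)
        | x <- [seq (t.1.2, t.2) | t <- sym_compose (res_rows i) l & p t.1.1]].
  by rewrite filter_map -!map_comp; apply: eq_map.
by rewrite (E id) (E negb); apply: perm_map.
Qed.

Lemma weights_gt0 i : (0 < w i)%N.
Proof.
by case: i => -[|[|[|[|]]]] //= i4; rewrite /weights /= addn_gt0 orbT.
Qed.

Lemma res_exact i (v : 'rV[S]_(res_rank i.+1)) :
  v *m res_diff i = 0 <-> exists u, v = u *m res_diff i.+1.
Proof.
have /and5P[_ _ cover _ _] := res_rows_check i.
exact (schreyer_exact (weights_gt0 (inord 3)) (size_rows i) (size_rows i.+1)
  (well_led_rows i) (well_led_rows i.+1) (@homogeneous_rows i.+1)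
  (covers_val m_gt0 cover) (diff_diff_rows i) v).
Qed.

Lemma msupp_rows_mx r' r (P : seq (seq (term 4))) j k x :
  x \in msupp (rows_mx K r' r P j k) ->
  exists2 t, t \in nth [::] P j & t.1.2 = k /\ t.2 = x.
Proof.
rewrite mxE /row_vec summxE => /msupp_sum_le.
rewrite filter_predT => /flatten_mapP[t tP].
rewrite mxE; case: eqP => [tk|]; last by rewrite msupp0.
move=> /msuppZ_le; rewrite msuppX inE => /eqP->.
by exists t.
Qed.

Lemma res_graded : graded w resolution.
Proof.
split=> [j x|i j k x] /=.
  rewrite mxE msupp1 inE => /eqP->.
  rewrite ord1 /res_deg /= add0r; congr Posz.
  by apply: eq_bigr => i _; rewrite !mnmE; case: i => -[|[|[|[|]]]].
case/msupp_rows_mx => t tj [tk <-].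
by rewrite -PoszD -tk addnC (deg_rows _ tj) ?size_rows.
Qed.

Lemma res_minimal : minimal resolution.
Proof.
move=> i j k; apply/eqP; rewrite mcoeff_eq0; apply/negP.
case/msupp_rows_mx => t tj [_ t0].
have ji : (j < size (res_rows i))%N.
  have : (j < res_rank i.+1)%N := ltn_ord j.
  by rewrite -size_rows size_map.
move: tj; rewrite (nth_map [::]) // => /mapP[s sl et].
have /and5P[_ _ _ _ /andP[_ /allP nz]] := res_rows_check i.
have /allP/(_ _ sl)/hasP[c] := nz _ (mem_nth [::] ji).
rewrite mem_iota => c4 /(exp_val_gt0 m_gt0).
have := congr1 (fun b : 'X_{1..4} => b (Ordinal c4)) t0.
by rewrite et /= !mnmE => ->.
Qed.

(** * The seven binomials generate the lattice ideal *)

Local Notation I := (lattice_ideal K (L m)).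
Local Notation B := [set f : S |
  exists u : 'rV[S]_7, f = (u *m (res_diff 0 : 'M_(7, 1))) 0 0]%classic.

Lemma lattice_ideal_is_ideal : is_ideal I.
Proof. exact: ideal_gen_is_ideal. Qed.

Lemma B_is_ideal : is_ideal B.
Proof.
split.
- by exists 0; rewrite mul0mx mxE.
- by move=> f g [u ->] [v ->]; exists (u + v); rewrite mulmxDl [RHS]mxE.
- by move=> a f [u ->]; exists (a *: u); rewrite -scalemxAl [RHS]mxE.
Qed.

Definition lead_exp (i : nat) : 'X_{1..4} := (lead (nth [::] (rows 0) i)).2.
Definition tail_exp (i : nat) : 'X_{1..4} :=
  (last (false, 0%N, 0%MM) (nth [::] (rows 0) i)).2.

(** Disjoint supports make the two exponents the positive and the negative part of the neighbor. *)
Lemma nbr_exp i (s : 'I_4) : (i < 7)%N ->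
  lat_pt m (nbr i) 0 s = (lead_exp i s)%:Z - (tail_exp i s)%:Z /\
  (lead_exp i s == 0%N) || (tail_exp i s == 0%N).
Proof.
move=> i7; rewrite lat_ptE.
have /allP/(_ i) : all (fun i => all (fun s =>
    let l := nth [::] res_rows0 i in
    let x := sym_exp (sym_lead l).2 s in
    let y := sym_exp (last (false, 0%N, [::]) l).2 s in
    (sym_at (nbr i) s == (x.1%:Z - y.1%:Z, x.2%:Z - y.2%:Z)) &&
    ((x == (0, 0)%N) || (y == (0, 0)%N))) (iota 0 4)) (iota 0 7).
  by vm_compute.
rewrite mem_iota => /(_ i7)/allP/(_ s); rewrite mem_iota ltn_ord => /(_ isT).
rewrite /lead_exp /tail_exp lead_rows /rows (nth_map [::]) //.
have -> : last (false, 0%N, 0%MM)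
      [seq term_val m t | t <- nth [::] (res_rows 0) i]
    = term_val m (last (false, 0%N, [::]) (nth [::] (res_rows 0) i)).
  by move: i7; do 7?[case: i => [|i] //].
move=> /andP[/eqP-> xy]; rewrite !mnmE /exp_val /lval /=; split.
  by rewrite !PoszD !PoszM; ring.
by case/orP: xy => /eqP ->; rewrite eqxx ?orbT.
Qed.

Lemma res_diff0E (j : 'I_7) :
  (res_diff 0 : 'M_(7, 1)) j 0 = 'X_[lead_exp j] - 'X_[tail_exp j].
Proof.
rewrite mxE /lead_exp /tail_exp /row_vec summxE.
by case: j => -[|[|[|[|[|[|[|//]]]]]]] j7;
  rewrite !big_cons big_nil !mxE /= addr0 expr0 expr1 scale1r scaleN1r.
Qed.

Lemma nbr_parts i : (i < 7)%N ->
  pos_part (lat_pt m (nbr i)) = lead_exp i /\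
  neg_part (lat_pt m (nbr i)) = tail_exp i.
Proof.
move=> i7; split; apply/mnmP => s; rewrite [LHS]mnmE.
  by have [-> /orP[/eqP->|/eqP->]] := nbr_exp s i7; lia.
rewrite [(- lat_pt m (nbr i)) 0 s]mxE.
by have [-> /orP[/eqP->|/eqP->]] := nbr_exp s i7; lia.
Qed.

(** A measure that drops when a leading monomial is replaced by its tail: the weighted degree stays
    and the exponent of x_4 grows. By [exponent_le_wdeg] the subtraction does not truncate. *)
Definition height (a : 'X_{1..4}) : nat := (wdeg w a - a (inord 3))%N.

Definition exp_diff (a b : 'X_{1..4}) : 'rV[int]_4 :=
  \row_s ((a s)%:Z - (b s)%:Z).

Lemma nbr_reduce i a : (i < 7)%N -> (lead_exp i <= a)%MM ->
  let a' := (a - lead_exp i + tail_exp i)%MM in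
  [/\ B ('X_[a] - 'X_[a']), (height a' < height a)%N
    & exp_diff a a' = lat_pt m (nbr i)].
Proof.
move=> i7 le_a a'; split.
- exists ('X_[a - lead_exp i] *: delta_mx 0 (Ordinal i7)).
  rewrite -scalemxAl -rowE mxE [X in _ * X]mxE res_diff0E mulrBr -!mpolyXD.
  by rewrite submK.
- have e3 := nbr_exp (inord 3) i7; have h3 := nbr_top m_gt0 i7.
  have [t0 l0] : (0 < tail_exp i (inord 3))%N /\ lead_exp i (inord 3) = 0%N.
    by case: e3 h3 => -> h h3; split; lia.
  (* All labels in homological degree 0 are empty, defaults included, so homogeneity of the row says
     that its two monomials have equal weighted degree. *)
  have wE : wdeg w (lead_exp i) = wdeg w (tail_exp i).
    have i0 : (i < size (rows 0))%N by rewrite size_rows.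
    have /allP/(_ _ (mem_nth [::] i0))/and3P[l0' _ _] := well_led_rows 0.
    have deg0 k : res_deg 0 k = res_deg 0 0.
      by rewrite /res_deg; case: k => //= k; rewrite nth_nil.
    have leadP : lead (nth [::] (rows 0) i) \in nth [::] (rows 0) i.
      by case: (nth _ _ _) l0' => // x l _; rewrite mem_head.
    have tailP : last (false, 0%N, 0%MM) (nth [::] (rows 0) i)
        \in nth [::] (rows 0) i.
      by case: (nth _ _ _) l0' => // x l _; rewrite /= mem_last.
    have := deg_rows i0 leadP; rewrite -(deg_rows i0 tailP).
    by rewrite deg0 [X in _ = (_ + X)%N]deg0 => /addIn.
  have wa : wdeg w a' = wdeg w a.
    by rewrite -[in RHS](submK le_a) !wdegD wE.
  have lt3 : (a (inord 3) < a' (inord 3))%N.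
    by rewrite mnmDE mnmBE l0 subn0 -[X in (X < _)%N]addn0 ltn_add2l.
  rewrite /height wa ltn_sub2l // (leq_trans lt3) // -wa.
  exact: exponent_le_wdeg (weights_gt0 _).
- apply/rowP => s; have [-> _] := nbr_exp s i7; rewrite mxE mnmDE mnmBE.
  by have /mnm_lepP/(_ s) := le_a; lia.
Qed.

(** Induction on the sum of the heights. By symmetry a - b has last coordinate at most 0; if it is
    nonzero, some neighbor h satisfies h^+ <= (a - b)^+ <= a, and a division step lowers the height
    of a while a - b stays in the lattice. *)
Lemma binomial_mem a b : L m (exp_diff a b) -> B ('X_[a] - 'X_[b]).
Proof.
have [B0 BD BM] := B_is_ideal.
have BN f : B f -> B (- f) by move=> /(BM (- 1)); rewrite mulN1r.
have [N] := ubnP (height a + height b)%N.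
elim: N a b => // N IH a b.
wlog top : a b / exp_diff a b 0 (inord 3) <= 0.
  move=> H ltN Lab; have [ab|/ltW ab] := leP (exp_diff a b 0 (inord 3)) 0.
    exact: H.
  rewrite -opprB; apply/BN/H; last 2 first.
  - by rewrite addnC.
  - have -> : exp_diff b a = 0 - exp_diff a b.
      by apply/rowP => s; rewrite !mxE; ring.
    by apply: L_sub => //; exact: L_zero.
  by move: ab; rewrite !mxE; lia.
rewrite ltnS => ltN Lab; have [->|nab] := eqVneq a b; first by rewrite subrr.
have /L_lat_pt[c ec] := Lab.
have [||i i7 le_i] := @exists_nbr_le m m_gt0 c; rewrite -?ec //.
  apply: contraNneq nab => e; apply/eqP/mnmP => s.
  by have := congr1 (fun v : 'rV_4 => v 0 s) e; rewrite !mxE; lia.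
have le_a : (lead_exp i <= a)%MM.
  apply/mnm_lepP => s; have := le_i s; rewrite -ec.
  by case: (nbr_exp s i7) => -> /orP[/eqP->|/eqP->]; rewrite mxE; lia.
have [Ba hlt ed] := nbr_reduce i7 le_a; move: Ba hlt ed.
set a' := (a - _ + _)%MM => Ba hlt ed.
have -> : 'X_[a] - 'X_[b] = ('X_[a] - 'X_[a']) + ('X_[a'] - 'X_[b]) :> S.
  by rewrite addrA subrK.
apply: BD => //; apply: IH; first by apply: leq_trans ltN; rewrite ltn_add2r.
have -> : exp_diff a' b = exp_diff a b - exp_diff a a'.
  by apply/rowP => s; rewrite !mxE; ring.
by apply: L_sub => //; rewrite ed; apply/L_lat_pt; exists (nbr i).
Qed.

Lemma lattice_idealE f : I f <-> B f.
Proof.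
split; first (apply: ideal_gen_min => //; first exact: B_is_ideal).
  move=> _ [u Lu <-]; apply: binomial_mem.
  suff -> : exp_diff (pos_part u) (neg_part u) = u by [].
  apply/rowP => s; rewrite !mxE !mnmE [(- u) 0 s]mxE.
  move: (u 0 s) => x; lia.
case=> u ->; rewrite mxE; have [I0 ID IM] := lattice_ideal_is_ideal.
apply: (big_ind (fun g => I g)) => // j _; apply: IM; rewrite res_diff0E.
have [<- <-] := nbr_parts (ltn_ord j); apply: ideal_gen_mem.
by exists (lat_pt m (nbr j)) => //; apply/L_lat_pt; exists (nbr j).
Qed.

Lemma res_resolves : resolves I resolution.
Proof.
have [I0 _ _] := lattice_ideal_is_ideal.
have augE (v : 'rV[S]_1) : (v *m (const_mx 1 : 'cV[S]_1)) 0 0 = v 0 0.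
  by rewrite mxE big_ord1 mxE mulr1.
split.
- by exists (const_mx 1 : 'rV[S]_1); rewrite augE mxE subrr.
- move=> v; rewrite (augE v); split => [/lattice_idealE[u eu]|[u ->]].
    by exists u; apply/rowP => k; rewrite ord1 eu.
  by apply/lattice_idealE; exists u.
- exact: res_exact.
Qed.

Theorem lattice_ideal_betti i : betti_eq w I i (res_rank i).
Proof.
have rI := res_resolves.
split.
  by exists resolution; split; [exact: res_graded| |exact: res_minimal].
move=> F [_ rF Fmin]; exact: (@minimal_resolution_rank _ _ _ F resolution i
  lattice_ideal_is_ideal rF rI Fmin res_minimal).
Qed.

End Resolution.

Theorem proposition3p8 (K : fieldType) (m : nat) (m_ge1 : (1 <= m)%N) :
  let I := lattice_ideal K (L m) in
  let beta := betti_eq (weights m) I in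
  [/\ beta 0%N 1%N, beta 1%N 7%N, beta 2%N 12%N, beta 3%N 6%N
    & forall i, (4 <= i)%N -> beta i 0%N] /\
  [/\ scarf_f_eq (L m) 0%N 7%N, scarf_f_eq (L m) 1%N 12%N
    & scarf_f_eq (L m) 2%N 6%N].
Proof.
move=> I beta; have betaE i : beta i (res_rank i) by exact: lattice_ideal_betti.
split.
  split; [exact (betaE 0)|exact (betaE 1)|exact (betaE 2)|exact (betaE 3)|].
  by move=> i i4; have := betaE i; rewrite /res_rank nth_default.
split.
- exact (scarf_f_faces m_ge1 (isT : 0 < 3)).
- exact (scarf_f_faces m_ge1 (isT : 1 < 3)).
- exact (scarf_f_faces m_ge1 (isT : 2 < 3)).
Qed.
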